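(* Let $f:\mathbb{R}\to\mathbb{R}$ satisfy (A1) and (A2). For a map $S:\mathbb{R}\times[0,+\infty[\,\to\mathbb{R}$, $(x_0,t)\mapsto S_t(x_0)$, the following are equivalent: (i) $S$ is a deterministic semigroup compatible with the ODE $\dot x=f(x)$; (ii) there exist a positive atomless Borel measure $\mu$ supported on $f^{-1}(0)$, a countable set $\mathcal{S}\subseteq f^{-1}(0)$, and a map $\Phi:\Omega^*\to\{-1,1\}$ such that $S$ coincides with the semigroup constructed from $(\mu,\mathcal{S},\Phi)$ as described in the context.
   Context: (A1): $f$ is bounded and regulated (left and right limits $f(x\pm)$ exist everywhere). (A2): if $f(y-)\cdot f(y+)=0$ or $f(y-)>0>f(y+)$, then $f(y)=0$. A Carathéodory solution of $\dot x=f(x)$, $x(0)=x_0$ is a function with $x(t)=x_0+\int_0^tf(x(s))\,ds$ for all $t\ge0$. A deterministic semigroup compatible with $\dot x=f(x)$ is a map $S:\mathbb{R}\times[0,\infty[\to\mathbb{R}$ with $S_0(x_0)=x_0$, $S_t(S_s(x_0))=S_{t+s}(x_0)$ for all $s,t\ge0$, $x_0\in\mathbb{R}$, and such that for each $x_0$ the map $t\mapsto S_t(x_0)$ is a Carathéodory solution starting at $x_0$ (no continuity in $x_0$ is required). Notation: $f^+=\max\{f,0\}$, $f^-=\min\{f,0\}$, with $1/f^+=+\infty$ where $f\le0$ and $1/f^-=-\infty$ where $f\ge 0$. $\mathcal{R}^-=\{x:\int_{x-\varepsilon}^x \frac{dy}{f^-(y)}>-\infty \text{ for some }\varepsilon>0\}$,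 $\mathcal{R}^+=\{x:\int_x^{x+\varepsilon}\frac{dy}{f^+(y)}<+\infty\text{ for some }\varepsilon>0\}$, $\Omega^*=\mathcal{R}^-\cap\mathcal{R}^+$. Construction from $(\mu,\mathcal{S},\Phi)$: an open interval $]a,b[$ is a domain of increase if $]a,b[\cap\mathcal{S}=\emptyset$ and $\mu([c,d])+\int_c^d\frac{dx}{f^+(x)}<\infty$ for all $[c,d]\subset]a,b[$; it is a domain of decrease if $]a,b[\cap\mathcal{S}=\emptyset$ and $\mu([c,d])-\int_c^d\frac{dx}{f^-(x)}<\infty$ for all $[c,d]\subset]a,b[$. Let $]\alpha_i,\beta_i[$ ($i\in\mathcal{I}^+$) be the disjoint maximal domains of increase and $]\gamma_i,\delta_i[$ ($i\in\mathcal{I}^-$) the disjoint maximal domains of decrease. Set $I_i^+=[\alpha_i,\beta_i[$ if $\alpha_i\notin\mathcal{S}$ and $\mu([\alpha_i,\alpha_i+\varepsilon])+\int_{\alpha_i}^{\alpha_i+\varepsilon}\frac{dx}{f^+(x)}<\infty$ for some $\varepsilon>0$, and $I_i^+=]\alpha_i,\beta_i[$ otherwise; set $I_i^-=]\gamma_i,\delta_i]$ if $\delta_i\notin\mathcal{S}$ and $\mu([\delta_i-\varepsilon,\delta_i])-\int_{\delta_i-\varepsilon}^{\delta_i}\frac{dx}{f^-(x)}<\infty$ for some $\varepsilon>0$, and $I_i^-=]\gamma_i,\delta_i[$ otherwise. For $x_0\in I_i^+$ let $\tau^+(x_0)=\mu([x_0,\beta_i])+\int_{x_0}^{\beta_i}\frac{dy}{f^+(y)}\in]0,+\infty]$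 and define $S^+_t(x_0)=x(t)$ where $\mu([x_0,x(t)])+\int_{x_0}^{x(t)}\frac{dy}{f^+(y)}=t$ if $t<\tau^+(x_0)$, and $x(t)=\beta_i$ if $t\ge\tau^+(x_0)$. For $x_0\in I_i^-$ let $\tau^-(x_0)=\mu([\gamma_i,x_0])-\int_{\gamma_i}^{x_0}\frac{dy}{f^-(y)}$ and define $S^-_t(x_0)=x(t)$ where $\mu([x(t),x_0])-\int_{x(t)}^{x_0}\frac{dy}{f^-(y)}=t$ if $t<\tau^-(x_0)$, and $x(t)=\gamma_i$ if $t\ge\tau^-(x_0)$. Then $S_t(x_0)=x_0$ if $x_0\notin(\bigcup_iI_i^+)\cup(\bigcup_iI_i^-)$; $S_t(x_0)=S^+_t(x_0)$ if $x_0\in(\bigcup_iI_i^+)\setminus(\bigcup_iI_i^-)$; $S_t(x_0)=S^-_t(x_0)$ if $x_0\in(\bigcup_iI_i^-)\setminus(\bigcup_iI_i^+)$; and if $x_0\in(\bigcup_iI_i^+)\cap(\bigcup_iI_i^-)$ (which implies $x_0\in\Omega^*$), $S_t(x_0)=S^+_t(x_0)$ if $\Phi(x_0)=1$ and $S_t(x_0)=S^-_t(x_0)$ if $\Phi(x_0)=-1$. *)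

(* Defs.v *)
From HB Require Import structures.
From mathcomp Require Import all_boot all_order all_algebra.
From mathcomp Require Import all_classical all_reals all_analysis.
Set Implicit Arguments. Unset Strict Implicit. Unset Printing Implicit Defensive.
Import Order.TTheory GRing.Theory Num.Theory.
Import numFieldNormedType.Exports.
Local Open Scope classical_set_scope.
Local Open Scope ring_scope.

(* Lebesgue (= Borel) measurable structure on R *)
Notation RB R := (measurableTypeR R).

Definition cc {R : realType} (c d : R) : set (RB R) := `[c, d]%classic.

Section defs.
Context {R : realType}.
Implicit Types (f : R -> R) (mu : {measure set (RB R) -> \bar R}) (Sg : set R).

Definition A1 f : Prop :=
  (exists M : R, forall x, `|f x| <= M) /\
  (forall x : R, cvg (f @ at_left x) /\ cvg (f @ at_right x)).

Definition fleft f (y : R) : R := lim (f @ at_left y).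
Definition fright f (y : R) : R := lim (f @ at_right y).

Definition A2 f : Prop :=
  forall y : R, (fleft f y * fright f y = 0 \/ (fleft f y > 0 /\ 0 > fright f y)) ->
    f y = 0.

Definition caratheodory f (x0 : R) (x : R -> R) : Prop :=
  forall t : R, 0 <= t ->
    (@lebesgue_measure R).-integrable (cc 0 t) (fun s => (f (x s))%:E) /\
    (x t)%:E = (x0%:E + \int[@lebesgue_measure R]_(s in (cc 0 t)) (f (x s))%:E)%E.

(* deterministic semigroup compatible with x' = f(x); S x0 t = S_t(x0),
   only the times t >= 0 are relevant *)
Definition compatible_semigroup f (S : R -> R -> R) : Prop :=
  (forall x0, S x0 0 = x0) /\
  (forall x0 s t, 0 <= s -> 0 <= t -> S (S x0 s) t = S x0 (t + s)) /\
  (forall x0, caratheodory f x0 (S x0)).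

Definition invfp f (y : R) : \bar R := if 0 < f y then ((f y)^-1)%:E else +oo%E.
Definition invfm f (y : R) : \bar R := if f y < 0 then ((f y)^-1)%:E else -oo%E.

Definition intcc (c d : R) (g : R -> \bar R) : \bar R :=
  \int[@lebesgue_measure R]_(y in (cc c d)) g y.

Definition Rminus_set f : set R :=
  [set x | exists2 e : R, 0 < e & (-oo < intcc (x - e) x (invfm f))%E].
Definition Rplus_set f : set R :=
  [set x | exists2 e : R, 0 < e & (intcc x (x + e) (invfp f) < +oo)%E].
Definition Omega_star f : set R := Rminus_set f `&` Rplus_set f.

Definition oo_int (a b : \bar R) : set R := [set x | (a < x%:E < b)%E].
Definition co_int (x0 : R) (b : \bar R) : set (RB R) :=
  [set y | x0 <= y /\ (y%:E <= b)%E].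
Definition oc_int (a : \bar R) (x0 : R) : set (RB R) :=
  [set y | (a <= y%:E)%E /\ y <= x0].

Definition dom_inc f mu Sg (a b : \bar R) : Prop :=
  (a < b)%E /\ oo_int a b `&` Sg = set0 /\
  forall c d : R, (cc c d) `<=` oo_int a b ->
    (mu (cc c d) + intcc c d (invfp f) < +oo)%E.
Definition dom_dec f mu Sg (a b : \bar R) : Prop :=
  (a < b)%E /\ oo_int a b `&` Sg = set0 /\
  forall c d : R, (cc c d) `<=` oo_int a b ->
    (mu (cc c d) - intcc c d (invfm f) < +oo)%E.

Definition max_dom_inc f mu Sg (a b : \bar R) : Prop :=
  dom_inc f mu Sg a b /\
  forall a' b', dom_inc f mu Sg a' b' -> oo_int a b `<=` oo_int a' b' ->
    a' = a /\ b' = b.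
Definition max_dom_dec f mu Sg (a b : \bar R) : Prop :=
  dom_dec f mu Sg a b /\
  forall a' b', dom_dec f mu Sg a' b' -> oo_int a b `<=` oo_int a' b' ->
    a' = a /\ b' = b.

Definition Iplus f mu Sg (a b : \bar R) : set R :=
  oo_int a b `|`
  [set x | a = x%:E /\ ~ Sg x /\
     exists2 e : R, 0 < e & (mu (cc x (x + e)) + intcc x (x + e) (invfp f) < +oo)%E].
Definition Iminus f mu Sg (a b : \bar R) : set R :=
  oo_int a b `|`
  [set x | b = x%:E /\ ~ Sg x /\
     exists2 e : R, 0 < e & (mu (cc (x - e) x) - intcc (x - e) x (invfm f) < +oo)%E].

Definition in_Iplus f mu Sg (x : R) : Prop :=
  exists a b, max_dom_inc f mu Sg a b /\ Iplus f mu Sg a b x.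
Definition in_Iminus f mu Sg (x : R) : Prop :=
  exists a b, max_dom_dec f mu Sg a b /\ Iminus f mu Sg a b x.

Definition Fplus f mu (x0 : R) (y : \bar R) : \bar R :=
  (mu (co_int x0 y) +
   \int[@lebesgue_measure R]_(z in co_int x0 y) invfp f z)%E.
Definition Fminus f mu (x0 : R) (y : \bar R) : \bar R :=
  (mu (oc_int y x0) -
   \int[@lebesgue_measure R]_(z in oc_int y x0) invfm f z)%E.

Definition Splus_spec f mu Sg (x0 t y : R) : Prop :=
  forall a b, max_dom_inc f mu Sg a b -> Iplus f mu Sg a b x0 ->
    let tau := Fplus f mu x0 b in
    ((t%:E < tau)%E -> x0 <= y /\ (y%:E < b)%E /\ Fplus f mu x0 y%:E = t%:E) /\
    ((tau <= t%:E)%E -> y%:E = b).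
Definition Sminus_spec f mu Sg (x0 t y : R) : Prop :=
  forall a b, max_dom_dec f mu Sg a b -> Iminus f mu Sg a b x0 ->
    let tau := Fminus f mu x0 a in
    ((t%:E < tau)%E -> y <= x0 /\ (a < y%:E)%E /\ Fminus f mu x0 y%:E = t%:E) /\
    ((tau <= t%:E)%E -> y%:E = a).

Definition constructed_semigroup f mu Sg (Phi : R -> R) (S : R -> R -> R) : Prop :=
  forall x0 t : R, 0 <= t ->
    (~ in_Iplus f mu Sg x0 -> ~ in_Iminus f mu Sg x0 -> S x0 t = x0) /\
    (in_Iplus f mu Sg x0 -> ~ in_Iminus f mu Sg x0 -> Splus_spec f mu Sg x0 t (S x0 t)) /\
    (~ in_Iplus f mu Sg x0 -> in_Iminus f mu Sg x0 -> Sminus_spec f mu Sg x0 t (S x0 t)) /\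
    (in_Iplus f mu Sg x0 -> in_Iminus f mu Sg x0 ->
       (Phi x0 = 1 -> Splus_spec f mu Sg x0 t (S x0 t)) /\
       (Phi x0 = -1 -> Sminus_spec f mu Sg x0 t (S x0 t))).

End defs.

(* Main.v *)
Require Import Defs.
From HB Require Import structures.
From mathcomp Require Import all_boot all_order all_algebra.
From mathcomp Require Import all_classical all_reals all_analysis.
From mathcomp Require Import measurable_realfun lra.
Set Implicit Arguments.
Unset Strict Implicit.
Unset Printing Implicit Defensive.
Import Order.TTheory GRing.Theory Num.Theory.
Import numFieldNormedType.Exports.
Local Open Scope classical_set_scope.
Local Open Scope ring_scope.

(** Let [m = mu + (1/f^+) dx], the measure of the time needed to travel to the
    right ([hitm] below).  A trajectory of the construction is the inverse of
    [y |-> m([x0,y])], so it pushes the Lebesgue measure on [[0,t]] forward to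
    [m] on [[x0,x(t)]]; as [f = 0] mu-a.e. and [f > 0] a.e. there, integrating
    [f] against [m] gives the length [x(t) - x0].  The decreasing side follows
    by the reflection [x |-> -x].

    Conversely an orbit of a semigroup cannot turn back: a level crossed upwards
    and then downwards would make the orbit periodic and confine it above that
    level.  Hence every point moves right, moves left, or is fixed.  The time
    spent by the right-moving orbits is a measure [nu] with [f nu = dx], so [nu]
    is [(1/f^+) dx] plus its restriction to [f = 0].  The measure [mu] is the sum
    of this restriction, of its left-moving counterpart, and of the (not
    sigma-finite) measure that is infinite on the sets containing uncountably
    many fixed points and zero on the others; the fixed points that the latter
    does not see from one side form the countable set [Sg]. *)

(** Fixed points are the obstacle in the converse. No orbit passes through one, so occupation times
    do not see them, and [1/f^+] may well be integrable across infinitely many of them, for instance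
    when [f] is near a Cantor set of small dimension the square root of the distance to it. Such a
    barrier can be uncountable, while [Sg] must be countable; infinite mass of an atomless measure
    is the other means of stopping the construction, and this is what the third summand of [mu]
    provides. The identity [f nu = dx] is a priori one between signed measures, since nothing says
    that [f >= 0] along a right-moving orbit. It is therefore handled through the positive and
    negative parts of [f], and the sign of [f] (almost everywhere for both measures) comes out as a
    consequence. In the direct implication, (A2) ensures that a point left neither to the right nor
    to the left is a zero of [f], so that resting there solves the equation. *)

(** * Regulated functions: countably many discontinuities, measurability *)

Section regulated_functions.
Context {R : realType}.
Implicit Type A : set R.

(** Choose a rational in each gap []x, x + e[]. Of two points with the same rational, the larger
    would lie in the gap of the smaller. *)
Lemma countable_right_isolated A :
  (forall x, A x -> exists2 e, 0 < e & forall y, x < y < x + e -> ~ A y) ->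
  countable A.
Proof.
move=> iA.
have /choice[q qP] : forall x, exists q : rat, A x ->
    x < ratr q /\ forall y, x < y -> y <= ratr q -> ~ A y.
  move=> x; have [Ax|nAx] := pselect (A x); last by exists 0.
  have [e e0 eP] := iA x Ax.
  have [q /itvP qe] := @rat_in_itvoo R x (x + e) ltac:(by rewrite ltrDl).
  exists q => _; split; first by rewrite qe.
  move=> y xy yq; apply: eP; rewrite xy/=.
  by apply: le_lt_trans yq _; rewrite qe.
apply/countable_injP; exists (choice.pickle \o q).
move=> x y; rewrite !inE => Ax Ay /= /(pcan_inj choice.pickleK) qxy.
have [xq xN] := qP x Ax; have [yq yN] := qP y Ay.
have [xy|yx|//] := ltgtP x y.
- by exfalso; apply: (xN y) => //; rewrite qxy; exact: ltW.
- by exfalso; apply: (yN x) => //; rewrite -qxy; exact: ltW.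
Qed.

Lemma countable_left_isolated A :
  (forall x, A x -> exists2 e, 0 < e & forall y, x - e < y < x -> ~ A y) ->
  countable A.
Proof.
move=> iA; have /countable_injP[h hi] : countable [set x | A (- x)].
  apply: countable_right_isolated => x /= /iA[e e0 eP]; exists e => // y.
  by move=> /andP[xy yx]; apply: eP; apply/andP; split; lra.
apply/countable_injP; exists (h \o -%R) => x y; rewrite !inE => Ax Ay /= hxy.
by apply: oppr_inj; apply: hi => //; rewrite inE/= opprK.
Qed.

Lemma at_right_near (f : R -> R) x l e : 0 < e -> f @ x^'+ --> l ->
  exists2 d, 0 < d & forall y, x < y < x + d -> `|l - f y| < e.
Proof.
move=> e0 /cvgrPdist_lt /(_ e e0) [d /= d0 dP]; exists d => // y /andP[xy yx].
by apply: dP => //=; rewrite distrC gtr0_norm; lra.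
Qed.

Lemma at_left_near (f : R -> R) x l e : 0 < e -> f @ x^'- --> l ->
  exists2 d, 0 < d & forall y, x - d < y < x -> `|l - f y| < e.
Proof.
move=> e0 /cvgrPdist_lt /(_ e e0) [d /= d0 dP]; exists d => // y /andP[xy yx].
by apply: dP => //=; rewrite gtr0_norm; lra.
Qed.

(* Jumps larger than [1/n] are isolated from the right, respectively left. *)
Lemma regulated_countable_discontinuity (f : R -> R) :
  (forall x : R, cvg (f @ x^'-) /\ cvg (f @ x^'+)) ->
  countable [set x | f x != lim (f @ x^'+) \/ f x != lim (f @ x^'-)].
Proof.
move=> rf.
pose Dr n := [set x | n.+1%:R^-1 < `|lim (f @ x^'+) - f x|].
pose Dl n := [set x | n.+1%:R^-1 < `|lim (f @ x^'-) - f x|].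
pose D (p : nat * bool) := if p.2 then Dr p.1 else Dl p.1.
apply: (@sub_countable _ _ _ (\bigcup_p D p)).
  apply: subset_card_le => x /= [] nx.
  - have : 0 < `|lim (f @ x^'+) - f x| by rewrite normr_gt0 subr_eq0 eq_sym.
    by move=> /ltr_add_invr[n]; rewrite add0r => nP; exists (n, true).
  - have : 0 < `|lim (f @ x^'-) - f x| by rewrite normr_gt0 subr_eq0 eq_sym.
    by move=> /ltr_add_invr[n]; rewrite add0r => nP; exists (n, false).
apply: bigcup_countable => // -[n []] _.
- apply: countable_right_isolated => x _.
  have n0 : 0 < n.+1%:R^-1 / 3 :> R by rewrite divr_gt0.
  have [d d0 dP] := at_right_near n0 (rf x).2.
  exists d => // y xyd; apply/negP; rewrite -leNgt.
  have [d' d'0 d'P] := at_right_near n0 (rf y).2.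
  have [yx xy] := andP xyd.
  (* [z] is close to [y] on its right and still in the gap at [x]. The right limit at [y] is near
     [f z], which is near the right limit at [x], which is near [f y]: three errors, hence the
     factor 3. *)
  pose z := y + Num.min d' (x + d - y) / 2.
  have m0 : 0 < Num.min d' (x + d - y) by rewrite lt_min d'0; lra.
  have m1 : Num.min d' (x + d - y) <= d' by rewrite ge_min lexx.
  have m2 : Num.min d' (x + d - y) <= x + d - y by rewrite ge_min lexx orbT.
  have := d'P z ltac:(rewrite /z; apply/andP; split; lra).
  have := dP z ltac:(rewrite /z; apply/andP; split; lra).
  have := dP y xyd.
  move: n0; set u : R := n.+1%:R^-1.
  rewrite !ltr_distl ler_distl => ? /andP[? ?] /andP[? ?] /andP[? ?].
  by apply/andP; split; lra.
- apply: countable_left_isolated => x _.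
  have n0 : 0 < n.+1%:R^-1 / 3 :> R by rewrite divr_gt0.
  have [d d0 dP] := at_left_near n0 (rf x).1.
  exists d => // y xyd; apply/negP; rewrite -leNgt.
  have [d' d'0 d'P] := at_left_near n0 (rf y).1.
  have [yx xy] := andP xyd.
  pose z := y - Num.min d' (y - (x - d)) / 2.
  have m0 : 0 < Num.min d' (y - (x - d)) by rewrite lt_min d'0; lra.
  have m1 : Num.min d' (y - (x - d)) <= d' by rewrite ge_min lexx.
  have m2 : Num.min d' (y - (x - d)) <= y - (x - d) by rewrite ge_min lexx orbT.
  have := d'P z ltac:(rewrite /z; apply/andP; split; lra).
  have := dP z ltac:(rewrite /z; apply/andP; split; lra).
  have := dP y xyd.
  move: n0; set u : R := n.+1%:R^-1.
  rewrite !ltr_distl ler_distl => ? /andP[? ?] /andP[? ?] /andP[? ?].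
  by apply/andP; split; lra.
Qed.

(** The preimage of an open ray is its interior plus points where [f] is discontinuous, hence an
    open set plus a countable one. *)
Lemma regulated_measurable (f : R -> R) :
  (forall x : R, cvg (f @ x^'-) /\ cvg (f @ x^'+)) -> measurable_fun setT f.
Proof.
move=> rf; have cD := regulated_countable_discontinuity rf.
apply: (measurability _ (RGenOInfty.measurableE R)) => //.
move=> _ [_ [c ->] <-]; rewrite setTI.
set W := f @^-1` _.
rewrite -(setDUK (@interior_subset R W)); apply: measurableU.
  by apply: open_measurable; exact: open_interior.
apply: countable_measurable => //; apply: sub_countable cD.
apply: subset_card_le => x /= [Wx nWx].
apply: contrapT => /not_orP[/negP/negPn/eqP fr /negP/negPn/eqP fl].
apply: nWx; rewrite /W/= in_itv/= andbT in Wx.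
have e0 : 0 < f x - c by lra.
have [d d0 dP] := at_right_near e0 (rf x).2.
have [d' d'0 d'P] := at_left_near e0 (rf x).1.
exists (Num.min d d') => /=; first by rewrite lt_min d0.
move=> y /=; rewrite lt_min !ltr_distl => /andP[/andP[? ?] /andP[? ?]].
rewrite /W/= in_itv/= andbT.
have [xy|yx|<-//] := ltgtP x y.
- have := dP y ltac:(by apply/andP; split; lra).
  by rewrite -fr ltr_distl => /andP[]; lra.
- have := d'P y ltac:(by apply/andP; split; lra).
  by rewrite -fl ltr_distl => /andP[]; lra.
Qed.

End regulated_functions.

(** * Measures given by a density with values in [[0, +oo]] *)

Section density.
Local Open Scope ereal_scope.
Context d (T : measurableType d) (R : realType).
Variables (m : {measure set T -> \bar R}) (g : T -> \bar R).
Hypotheses (mg : measurable_fun setT g) (g0 : forall x, 0 <= g x).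

(** The two proofs are arguments so that the measure structure can be inferred from the term. *)
Definition mdensity of measurable_fun setT g & (forall x, 0 <= g x) :=
  fun A : set T => \int[m]_(x in A) g x.

Local Notation nu := (mdensity mg g0).

Let nu0 : nu set0 = 0. Proof. exact: integral_set0. Qed.

Let nu_ge0 A : 0 <= nu A. Proof. exact: integral_ge0. Qed.

Let nu_sigma_additive : semi_sigma_additive nu.
Proof.
move=> F mF tF mUF; rewrite /mdensity ge0_integral_bigcup//.
- by apply: is_cvg_ereal_nneg_natsum_cond => n _ _; exact: integral_ge0.
- exact: measurable_funTS.
Qed.

HB.instance Definition _ := isMeasure.Build _ _ _ nu nu0 nu_ge0 nu_sigma_additive.

Import HBNNSimple.

Lemma ge0_integral_mdensity (D : set T) (h : T -> \bar R) : measurable D ->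
  measurable_fun setT h -> (forall x, 0 <= h x) ->
  \int[nu]_(x in D) h x = \int[m]_(x in D) (h x * g x).
Proof.
move=> mD mh h0.
have mhD : measurable_fun D h by exact: measurable_funTS.
have mgD : measurable_fun D g by exact: measurable_funTS.
pose h_ := nnsfun_approx mD mhD.
have h_g0 n x : 0 <= (h_ n x)%:E * g x by rewrite mule_ge0// lee_fin.
transitivity (limn (fun n => \int[nu]_(x in D) (h_ n x)%:E)).
  rewrite -monotone_convergence//.
  - apply: eq_integral => y /[!inE] yD; apply/esym/cvg_lim => //.
    by apply: cvg_nnsfun_approx=> // *; exact: h0.
  - by move=> n; exact/measurable_EFinP/measurable_funTS.
  - by move=> n y _; rewrite lee_fin.
  - by move=> y _ i j ij; rewrite lee_fin; exact/lefP/nd_nnsfun_approx.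
rewrite [X in limn X](_ : _ =
    (fun n => \int[m]_(x in D) ((h_ n x)%:E * g x))).
  rewrite -monotone_convergence//.
  - apply: eq_integral => x /[!inE] Dx; apply/cvg_lim => //.
    have := @cvg_nnsfun_approx _ _ _ _ mD _ mhD (fun x _ => h0 x) x Dx.
    move=> hx; rewrite -/h_ in hx.
    have [gx|gx] := boolP (g x \is a fin_num); first exact: cvgeZr.
    (* Now [g x = +oo]. The product is continuous there unless [h x = 0], in which case the
       approximants, lying below [h], vanish at [x] as well. *)
    have [hx0|hx0] := eqVneq (h x) 0; last first.
      by apply: cvgeM => //; [exact: mule_def_neq0_infty|exact: cvg_cst].
    rewrite hx0 mul0e; have -> : (fun n => (h_ n x)%:E * g x) = cst 0.
      apply/funext => n /=; suff -> : (h_ n x)%:E = 0 by rewrite mul0e.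
      apply/eqP; rewrite eq_le; apply/andP; split; last by rewrite lee_fin.
      by rewrite -[leRHS]hx0 /h_ nnsfun_approxE; exact: le_approx.
    exact: cvg_cst.
  - move=> n; apply: emeasurable_funM => //.
    exact/measurable_EFinP/measurable_funTS.
  - move=> x _ i j ij; rewrite lee_wpmul2r// lee_fin.
    exact/lefP/nd_nnsfun_approx.
apply/funext => n.
have mi r : measurable_fun D (fun x => (r * \1_(h_ n @^-1` [set r]) x)%:E).
  by apply: (measurable_comp measurableT) => //; exact: measurable_funM.
transitivity (\sum_(k \in range (h_ n))
    \int[nu]_(x in D) (k * \1_(h_ n @^-1` [set k]) x)%:E).
  rewrite -ge0_integral_fsum//; last first.
    by move=> r y _; exact: nnfun_muleindic_ge0.
  by apply: eq_integral => x _; rewrite fsumEFin// -fimfunE.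
transitivity (\sum_(k \in range (h_ n))
    \int[m]_(x in D) ((k * \1_(h_ n @^-1` [set k]) x)%:E * g x)); last first.
  rewrite -ge0_integral_fsum//; last 2 first.
  - by move=> r; exact: emeasurable_funM.
  - by move=> r y _; rewrite mule_ge0//; exact: nnfun_muleindic_ge0.
  apply: eq_integral => x _; rewrite -ge0_mule_fsuml; last first.
    by move=> y; exact: nnfun_muleindic_ge0.
  by rewrite fsumEFin// -fimfunE.
apply: eq_fsbigr => r /[!inE] -[z _ <-].
have mz : measurable (h_ n @^-1` [set h_ n z]) by exact: measurable_sfunP.
rewrite integralZl_indic_nnsfun// integral_indic//=.
under eq_integral do rewrite EFinM -muleA.
rewrite ge0_integralZl//=; last 3 first.
- by apply: emeasurable_funM => //; exact/measurable_EFinP.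
- by move=> x _; rewrite mule_ge0// lee_fin.
- by rewrite lee_fin.
congr (_ * _); rewrite /mdensity setIC integral_mkcondr/=.
by apply: eq_integral => x _; rewrite muleC epatch_indic.
Qed.

End density.

Section measure_complements.
Local Open Scope ereal_scope.
Context d (T : measurableType d) (R : realType).
Variables (m : {measure set T -> \bar R}).

Lemma ge0_integral_mrestr (A D : set T) (mD : measurable D) (h : T -> \bar R) :
  measurable A -> measurable_fun A h -> (forall x, A x -> 0 <= h x) ->
  \int[mrestr m mD]_(x in A) h x = \int[m]_(x in A `&` D) h x.
Proof.
move=> mA mh h0.
rewrite [LHS](@ge0_negligible_integral _ _ _ _ _ (~` D))//.
- rewrite setDE setCK; apply: (eq_measure_integral m) => B mB BD.
  by rewrite /= /mrestr setIidl// => x /BD[].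
- exact: measurableC.
- by rewrite /= /mrestr setICl measure0.
Qed.

Lemma ge0_integral_mu0 (A N : set T) (h : T -> \bar R) : measurable A ->
  measurable N -> measurable_fun A h -> (forall x, A x -> 0 <= h x) ->
  m N = 0 -> (forall x, A x -> ~ N x -> h x = 0) ->
  \int[m]_(x in A) h x = 0.
Proof.
move=> mA mN mh h0 mN0 hN.
rewrite (ge0_negligible_integral mN mA)//.
by apply: integral0_eq => x [Ax Nx]; exact: hN.
Qed.

End measure_complements.

(** * Measures on segments, and the hitting measure [hitm] *)

Section segments.
Context {R : realType}.
Implicit Types (m mu : {measure set (RB R) -> \bar R}) (f : R -> R) (c d x : R).
Local Notation leb := (@lebesgue_measure R).

Lemma measurable_cc c d : measurable (cc c d). Proof. exact: measurable_itv. Qed.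
Hint Resolve measurable_cc : core.

Lemma ccP c d x : cc c d x <-> (c <= x <= d)%R.
Proof. by rewrite /cc/= in_itv. Qed.

Lemma subset_cc c d c' d' : c' <= c -> d <= d' -> cc c d `<=` cc c' d'.
Proof.
move=> cc' dd' x /ccP/andP[cx xd]; apply/ccP.
by rewrite (le_trans cc')//= (le_trans xd).
Qed.

Lemma le_measure_cc m c d c' d' : c' <= c -> d <= d' ->
  (m (cc c d) <= m (cc c' d'))%E.
Proof. by move=> *; rewrite le_measure ?inE//; exact: subset_cc. Qed.

Lemma lebesgue_cc c d : c <= d -> leb (cc c d) = (d - c)%:E.
Proof.
move=> cd; rewrite lebesgue_measure_itv/= lte_fin; case: ltgtP cd => // -> _.
by rewrite subrr.
Qed.

Lemma measure_cc_split m c x d : c <= x -> x <= d ->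
  m (cc c d) = (m (cc c x) + m `]x, d]%classic)%E.
Proof.
move=> cx xd; rewrite -measureU//.
- congr (m _); apply/seteqP; split=> y.
    move=> /ccP/andP[cy yd]; have [yx|xy] := leP y x; [left|right].
      by apply/ccP; rewrite cy.
    by rewrite /= in_itv/= xy.
  move=> [/ccP/andP[cy yx]|/=].
    by apply/ccP; rewrite cy (le_trans yx).
  by rewrite in_itv/= => /andP[xy yd]; apply/ccP; rewrite yd (le_trans cx)// ltW.
- apply/seteqP; split=> y //= [/ccP/andP[_ yx]]; rewrite in_itv/= => /andP[xy _].
  by move: (lt_le_trans xy yx); rewrite ltxx.
Qed.

(** Uniqueness on the pi-system of rays []x, +oo[], applied to the restrictions to [[c, d]], which
    are finite measures. *)
Lemma measure_unique_segment m1 m2 c d : c <= d ->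
  (forall y, c <= y <= d -> m1 (cc c y) = m2 (cc c y)) ->
  (m1 (cc c d) < +oo)%E ->
  forall A, measurable A -> A `<=` cc c d -> m1 A = m2 A.
Proof.
move=> cd m12 m1oo A mA Acd.
suff : mrestr m1 (measurable_cc c d) A = mrestr m2 (measurable_cc c d) A.
  by rewrite /mrestr setIidl.
apply: (@measure_unique _ R (RB R) (@RGenOInfty.G R)
  (fun k => `]- k%:R, +oo[%classic) _ _ _ _
  (mrestr m1 (measurable_cc c d)) (mrestr m2 (measurable_cc c d))) => //.
- exact: RGenOInfty.measurableE.
- move=> _ _ [x ->] [y ->]; exists (Num.max x y).
  apply/seteqP; split => z /=; rewrite !in_itv/= !andbT gt_max.
    by move=> [-> ->].
  by move=> /andP[].
- by move=> k; exists (- k%:R).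
- rewrite -subTset => x _; exists (Num.truncn `|x|).+1 => //=.
  rewrite in_itv/= andbT ltrNl.
  by apply: le_lt_trans (ler_norm _) _; rewrite normrN truncnS_gt.
- move=> _ [x ->]; rewrite /= /mrestr.
  have [xc|cx] := ltP x c.
    rewrite setIidr; first by apply: m12; rewrite cd lexx.
    move=> z /ccP/andP[cz _]; rewrite /= in_itv/= andbT.
    exact: lt_le_trans cz.
  have [dx|xd] := ltP d x.
    rewrite (_ : _ `&` _ = set0) ?measure0//; apply/seteqP; split => z //=.
    rewrite in_itv/= andbT => -[xz /ccP/andP[_ zd]].
    by move: (lt_trans dx xz); rewrite ltNge zd.
  rewrite (_ : _ `&` _ = `]x, d]%classic); last first.
    apply/seteqP; split => z /=; rewrite !in_itv/= ?andbT.
      by move=> [-> /ccP/andP[_ ->]].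
    by move=> /andP[xz zd]; split => //; apply/ccP; rewrite zd (le_trans cx)// ltW.
  (* The ray cuts the segment in []x, d]]; its mass is found by cancelling that of [[c, x]], which
     has to be finite. *)
  have fx : m1 (cc c x) \is a fin_num.
    by rewrite ge0_fin_numE//; apply: le_lt_trans m1oo; exact: le_measure_cc.
  have : (m1 (cc c x) + m1 `]x, d]%classic = m1 (cc c x) + m2 `]x, d]%classic)%E.
    rewrite -(measure_cc_split m1)// m12 ?cd ?lexx//.
    by rewrite (measure_cc_split m2 cx xd) m12 ?cx.
  by move/(congr1 (fun u => u - m1 (cc c x)))%E; rewrite ![(m1 (cc c x) + _)%E]addeC !addeK.
- move=> k; apply: le_lt_trans m1oo; rewrite /= /mrestr.
  by rewrite le_measure ?inE//; exact: measurableI.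
Qed.

Lemma measurable_invfp f : measurable_fun setT f ->
  measurable_fun setT (invfp f : RB R -> \bar R).
Proof.
move=> mf; have -> : invfp f =
    fun y => if 0 < f y then (f y `^ (-1))%:E else +oo%E.
  by apply/funext => y; rewrite /invfp; case: ifPn => // /ltW/powR_inv1 ->.
apply: measurable_fun_ifT => //; first exact: measurable_fun_ltr.
apply/measurable_EFinP; apply: (measurableT_comp (f := fun y => y `^ (-1))) mf.
exact: measurable_powR.
Qed.

Lemma invfp_ge0 f x : (0 <= invfp f x)%E.
Proof.
by rewrite /invfp; case: ifPn => // f0; rewrite lee_fin invr_ge0 ltW.
Qed.

Definition hitm f (mf : measurable_fun setT f) mu :
    {measure set (RB R) -> \bar R} :=
  measure_add mu (mdensity leb (measurable_invfp mf) (invfp_ge0 f)).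

Section hitm.
Variables (f : R -> R) (mf : measurable_fun setT f).
Variables (M : R) (fM : forall x, `|f x| <= M).

Lemma hitmE mu A :
  hitm mf mu A = (mu A + \int[leb]_(x in A) invfp f x)%E.
Proof. exact: measure_addE. Qed.

Lemma hitm_lty mu A : measurable A -> (hitm mf mu A < +oo)%E ->
  (mu A < +oo)%E /\ (\int[leb]_(x in A) invfp f x < +oo)%E.
Proof.
move=> mA; rewrite hitmE => h.
have i0 : (0 <= \int[leb]_(x in A) invfp f x)%E.
  by apply: integral_ge0 => x _; exact: invfp_ge0.
split; apply: le_lt_trans h; first by rewrite leeDl.
by rewrite leeDr.
Qed.

Lemma hitm_set1 mu x : mu [set x] = 0%E -> hitm mf mu [set x] = 0%E.
Proof. by move=> mux; rewrite hitmE mux integral_set1 adde0. Qed.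

Lemma hitm_cc_split mu c x d : mu [set x] = 0%E -> c <= x -> x <= d ->
  hitm mf mu (cc c d) = (hitm mf mu (cc c x) + hitm mf mu (cc x d))%E.
Proof.
move=> mux cx xd; rewrite (measure_cc_split _ cx xd); congr (_ + _)%E.
rewrite [RHS](@measure_cc_split _ _ x)//.
suff -> : cc x x = [set x] by rewrite hitm_set1// add0e.
by rewrite /cc set_itv1.
Qed.

(** A bounded speed makes every length cost time. This gives the strict monotonicity of [hitm] and
    forbids reaching infinity in finite time. The bound [M] may be 0, hence [M + 1]. *)
Lemma hitm_cc_ge mu c d : c <= d ->
  (((d - c) / (M + 1))%:E <= hitm mf mu (cc c d))%E.
Proof.
move=> cd; have M0 : 0 < M + 1 by have := le_trans (normr_ge0 _) (fM 0); lra.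
apply: (@le_trans _ _ (\int[leb]_(x in cc c d) invfp f x)%E); last first.
  by rewrite hitmE leeDr.
apply: (@le_trans _ _ (\int[leb]_(x in cc c d) ((M + 1)^-1)%:E)%E).
  by rewrite integral_cst//= lebesgue_cc// -EFinM mulrC.
apply: ge0_le_integral => //.
- by move=> x _; rewrite lee_fin invr_ge0 ltW.
- by apply: measurable_funTS; exact: measurable_invfp.
- move=> x _; rewrite /invfp; case: ifPn => f0; last by rewrite leey.
  by rewrite lee_fin lef_pV2 ?posrE//; have := fM x; rewrite ler_norml => /andP[]; lra.
Qed.

Lemma hitm_cc_lt mu c x y : c <= x -> x < y -> mu [set x] = 0%E ->
  (hitm mf mu (cc c x) < +oo)%E ->
  (hitm mf mu (cc c x) < hitm mf mu (cc c y))%E.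
Proof.
move=> cx xy mux cxoo; rewrite (hitm_cc_split mux cx (ltW xy)).
rewrite lteDl ?ge0_fin_numE//; apply: lt_le_trans (hitm_cc_ge _ (ltW xy)).
by rewrite lte_fin divr_gt0//; have := le_trans (normr_ge0 _) (fM 0); lra.
Qed.

(** The convention [1/f^+ = +oo] where [f <= 0] turns integrability into a sign condition almost
    everywhere. *)
Lemma invfp_lty_pos A : measurable A ->
  (\int[leb]_(x in A) invfp f x < +oo)%E ->
  leb (A `&` [set x | f x <= 0]) = 0%E.
Proof.
move=> mA Aoo.
have mN : measurable (A `&` [set x | f x <= 0]).
  apply: measurableI => //; rewrite -[X in measurable X]setTI.
  exact: measurable_fun_le.
apply: contrapT => /eqP nz.
have : (\int[leb]_(x in A `&` [set x | (f x <= 0)%R]) invfp f x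
    <= \int[leb]_(x in A) invfp f x)%E.
  apply: ge0_subset_integral => //; first by apply: measurable_funTS; exact: measurable_invfp.
  by move=> x _; exact: invfp_ge0.
rewrite (eq_integral (cst +oo%E)); last first.
  by move=> x; rewrite inE => -[_ /= fx]; rewrite /invfp ltNge fx.
rewrite integral_cst// gt0_mulye; last by rewrite lt0e nz measure_ge0.
by rewrite leye_eq => /eqP Aoo'; rewrite Aoo' in Aoo.
Qed.

End hitm.

End segments.
#[global] Hint Resolve measurable_cc : core.

(** * Change of variable between time and position *)

Section time_change.
Context {R : realType}.
Implicit Types (m mu : {measure set (RB R) -> \bar R}) (f g : R -> R) (c d x : R).
Local Notation leb := (@lebesgue_measure R).

Definition mpush (phi : RB R -> RB R) of measurable_fun setT phi :=
  fun m (A : set (RB R)) => m (phi @^-1` A).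

Section mpush.
Variables (phi : RB R -> RB R) (mphi : measurable_fun setT phi).
Variable m : {measure set (RB R) -> \bar R}.

Let mpreim (A : set (RB R)) : measurable A -> measurable (phi @^-1` A : set (RB R)).
Proof. by move=> mA; rewrite -[X in measurable X]setTI; exact: mphi. Qed.

Let mpush0 : mpush mphi m set0 = 0%E.
Proof. by rewrite /mpush preimage_set0 measure0. Qed.

Let mpush_ge0 A : (0 <= mpush mphi m A)%E. Proof. exact: measure_ge0. Qed.

Let mpush_sigma_additive : semi_sigma_additive (mpush mphi m).
Proof.
move=> F mF tF mUF; rewrite /mpush preimage_bigcup.
apply: measure_semi_sigma_additive.
- by move=> n; exact: mpreim.
- apply/trivIsetP => /= i j _ _ ij; rewrite -preimage_setI.
  by move/trivIsetP : tF => /(_ _ _ _ _ ij) ->//; rewrite preimage_set0.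
- by rewrite -preimage_bigcup; exact: mpreim.
Qed.

HB.instance Definition _ := isMeasure.Build _ (RB R) R
  (mpush mphi m) mpush0 mpush_ge0 mpush_sigma_additive.

Lemma ge0_integral_mpush (D : set (RB R)) (h : RB R -> \bar R) :
  measurable D -> measurable_fun D h -> (forall y, D y -> 0 <= h y)%E ->
  (\int[mpush mphi m]_(y in D) h y = \int[m]_(x in phi @^-1` D) h (phi x))%E.
Proof.
move=> mD mh h0; apply: (ge0_integral_pushforward mphi m mD mh).
by move=> y /[!inE]; exact: h0.
Qed.

End mpush.

Lemma bounded_cc_integrable g M c d : measurable_fun (cc c d) g ->
  (forall s, `|g s| <= M) -> leb.-integrable (cc c d) (fun s => (g s)%:E).
Proof.
move=> mg gM; apply: measurable_bounded_integrable => //.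
  have [cd|dc] := leP c d; first by rewrite /= lebesgue_cc// ltry.
  by rewrite /cc set_itv_ge ?measure0// bnd_simp -ltNge.
by exists M; split; [exact: num_real|move=> y My s _; apply: le_trans (ltW My)].
Qed.

(** The transport formulas are for nonnegative integrands; a signed [g] enters them through
    [pospart g] and [pospart (-%R \o g)]. *)
Definition pospart f (y : R) : \bar R := (Num.max (f y) 0)%:E.

Lemma pospart_ge0 f y : (0 <= pospart f y)%E.
Proof. by rewrite lee_fin le_max lexx orbT. Qed.

Lemma measurable_pospart f : measurable_fun setT f ->
  measurable_fun setT (pospart f : RB R -> \bar R).
Proof. by move=> mf; apply/measurable_EFinP; exact: measurable_maxr. Qed.

Lemma integral_pospart (A : set (RB R)) g :
  (\int[leb]_(s in A) (g s)%:E =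
   \int[leb]_(s in A) pospart g s - \int[leb]_(s in A) pospart (-%R \o g) s)%E.
Proof.
rewrite integralE; congr (_ - _)%E; apply: eq_integral => s _.
  by rewrite funeposE /pospart EFin_max.
by rewrite funenegE /pospart EFin_max.
Qed.

Variables (f : R -> R) (mf : measurable_fun setT f).
Variables (M : R) (fM : forall x, `|f x| <= M).
Variable mu : {measure set (RB R) -> \bar R}.
Hypothesis mu1 : forall x, mu [set x] = 0%E.
Hypothesis muf : mu (~` (f @^-1` [set 0])) = 0%E.
Local Notation m := (hitm mf mu).

Let mZ : measurable (~` (f @^-1` [set 0]) : set (RB R)).
Proof.
apply: measurableC; rewrite -[X in measurable X]setTI.
exact: mf.
Qed.

Section pushforward_of_time.
Variables (x0 T : R) (x : R -> R).
Hypothesis T0 : 0 <= T.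
Hypothesis xP : forall s, 0 <= s <= T -> x0 <= x s /\ m (cc x0 (x s)) = s%:E.

Let x_lt s t : 0 <= s -> s < t -> t <= T -> x s < x t.
Proof.
move=> s0 st tT; rewrite ltNge; apply/negP => xts.
have [_ ms] := xP ltac:(apply/andP; split; [exact: s0|lra]).
have [_ mt] := xP (s := t) ltac:(apply/andP; split; lra).
have := le_measure_cc m (lexx x0) xts.
by rewrite ms mt lee_fin leNgt st.
Qed.

(** Clamping the time to [[0, T]] makes the trajectory monotone, hence measurable, on the whole
    line. *)
Let phi (s : RB R) : RB R := x (Num.max 0 (Num.min s T)).

Let phiE s : 0 <= s <= T -> phi s = x s.
Proof. by move=> /andP[s0 sT]; rewrite /phi (min_idPl sT) (max_idPr s0). Qed.

Let clampP s : 0 <= Num.max 0 (Num.min s T) <= T.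
Proof. by rewrite le_max lexx/= ge_max T0 ge_min lexx orbT. Qed.

Let mphi : measurable_fun setT phi.
Proof.
apply: nondecreasing_measurable => // s t st.
have : Num.max 0 (Num.min s T) <= Num.max 0 (Num.min t T).
  rewrite ge_max le_max lexx/= le_max; apply/orP; right.
  by rewrite le_min !ge_min lexx st !orbT.
rewrite le_eqVlt => /predU1P[h|h]; first by rewrite /phi h.
apply: ltW; apply: x_lt => //; first by have /andP[] := clampP s.
by have /andP[] := clampP t.
Qed.

Let rho := mpush mphi (mrestr leb (measurable_cc 0 T)).

(** It is enough to compare on segments [[x0, y]]: the trajectory stays in such a segment exactly up
    to the time [m (cc x0 y)], because [m] charges every nontrivial segment. *)
Let rhoE A : measurable A -> A `<=` cc x0 (x T) -> rho A = m A.
Proof.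
have [xT mT] := xP (s := T) ltac:(by rewrite T0 lexx).
move=> mA; apply: measure_unique_segment => //; last first.
  rewrite /rho /= /mpush/= /mrestr.
  apply: (@le_lt_trans _ _ (leb (cc 0 T))); last by rewrite /= lebesgue_cc// ltry.
  rewrite le_measure ?inE//; apply: measurableI => //.
  by rewrite -[X in measurable X]setTI; exact: mphi.
move=> y /andP[xy yT].
have my : m (cc x0 y) \is a fin_num.
  rewrite ge0_fin_numE//; apply: (@le_lt_trans _ _ (m (cc x0 (x T)))).
    exact: le_measure_cc.
  by rewrite mT ltry.
have [s ms] : exists s, m (cc x0 y) = s%:E by exists (fine (m (cc x0 y))); rewrite fineK.
have s0 : 0 <= s by rewrite -lee_fin -ms.
have sT : s <= T by rewrite -lee_fin -ms -mT; exact: le_measure_cc.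
rewrite ms /rho/= /mpush/= /mrestr (_ : _ `&` _ = cc 0 s).
  by rewrite lebesgue_cc// subr0.
apply/seteqP; split => t /=.
  move=> [/ccP/andP[_ ty] /ccP tT]; apply/ccP; rewrite (andP tT).1/=.
  rewrite phiE// in ty; have [_ mt] := xP tT.
  by rewrite -lee_fin -ms -mt; exact: le_measure_cc.
move=> /ccP/andP[t0 ts]; have tT : (0 : R) <= t <= T by rewrite t0; exact: le_trans ts sT.
split; last exact/ccP; apply/ccP; rewrite phiE//; have [xt mt] := xP tT.
rewrite xt/= leNgt; apply/negP => yt.
have := hitm_cc_lt (mf := mf) fM xy yt (mu1 y).
by rewrite ms mt ltry => /(_ erefl); rewrite lte_fin ltNge ts.
Qed.

Lemma ge0_integral_time (h : R -> \bar R) : measurable_fun setT h ->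
  (forall y, 0 <= h y)%E ->
  (\int[leb]_(s in cc 0 T) h (x s) = \int[mu]_(y in cc x0 (x T)) h y +
     \int[leb]_(y in cc x0 (x T)) (h y * invfp f y))%E.
Proof.
move=> mh h0; transitivity (\int[m]_(y in cc x0 (x T)) h y)%E; last first.
  rewrite ge0_integral_measure_add//; last exact: measurable_funTS.
  by rewrite ge0_integral_mdensity.
rewrite [RHS](eq_measure_integral (mpush mphi (mrestr leb (measurable_cc 0 T)))).
  2: by move=> A mA AxT; rewrite -rhoE.
rewrite ge0_integral_mpush//; last exact: measurable_funTS.
have mhphi : measurable_fun setT (h \o phi) by exact: measurableT_comp.
rewrite ge0_integral_mrestr//; last 2 first.
- by rewrite -[X in measurable X]setTI; exact: mphi.
- exact: measurable_funTS.
rewrite setIidr; first by apply: eq_integral => s /[!inE] /ccP sT; rewrite phiE.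
move=> s /ccP sT; apply/ccP; rewrite phiE//; have [-> _] := xP sT.
have /andP[s0] := sT; rewrite le_eqVlt => /predU1P[->|sT']; first exact: lexx.
exact: (ltW (x_lt s0 sT' (lexx T))).
Qed.

Let leb0 : leb (cc x0 (x T) `&` [set y | f y <= 0]) = 0%E.
Proof.
apply: invfp_lty_pos => //.
have [_ mT] := xP (s := T) ltac:(by rewrite T0 lexx).
by apply: (hitm_lty (mf := mf) (mu := mu) _ _).2 => //; rewrite mT ltry.
Qed.

Let mN : measurable (cc x0 (x T) `&` [set y | f y <= 0] : set (RB R)).
Proof.
apply: measurableI => //; rewrite -[X in measurable X]setTI.
exact: measurable_fun_le.
Qed.

Lemma inverse_caratheodory :
  leb.-integrable (cc 0 T) (fun s => (f (x s))%:E) /\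
  (x T)%:E = (x0%:E + \int[leb]_(s in cc 0 T) (f (x s))%:E)%E.
Proof.
have [xT mT] := xP (s := T) ltac:(by rewrite T0 lexx).
split.
  apply: (@eq_integrable _ _ _ _ _ (measurable_cc 0 T) (fun s => (f (phi s))%:E)).
    by move=> s /[!inE] /ccP sT; rewrite phiE.
  apply: (@bounded_cc_integrable (f \o phi) M) => [|s]; last exact: fM.
  by apply: measurable_funTS; exact: measurableT_comp.
suff -> : (\int[leb]_(s in cc 0 T) (f (x s))%:E = (x T - x0)%:E)%E.
  by rewrite -EFinD addrC subrK.
transitivity (\int[leb]_(s in cc 0 T) pospart (f \o x) s -
    \int[leb]_(s in cc 0 T) pospart (-%R \o (f \o x)) s)%E.
  exact: (integral_pospart (cc 0 T) (f \o x)).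
have mfN : measurable_fun setT (-%R \o f) by exact: measurableT_comp.
have mpi : measurable_fun setT (invfp f : RB R -> \bar R) by exact: measurable_invfp.
have -> : (\int[leb]_(s in cc 0 T) pospart (f \o x) s = (x T - x0)%:E)%E.
  transitivity (\int[leb]_(s in cc 0 T) pospart f (x s))%E => //.
  rewrite (ge0_integral_time (measurable_pospart mf)); last exact: pospart_ge0.
  rewrite (ge0_integral_mu0 _ mZ)//; last 3 first.
  - by apply: measurable_funTS; exact: measurable_pospart.
  - by move=> y _; exact: pospart_ge0.
  - by move=> y _ /= /contrapT fy; rewrite /pospart fy maxxx.
  (* Since the hitting time is finite, [{f <= 0}] is Lebesgue-null on the segment ([leb0]); off it
     the integrand is [f * (1 / f) = 1]. *)
  rewrite add0e (ge0_negligible_integral mN)//; last 2 first.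
  - apply: measurable_funTS; apply: emeasurable_funM => //.
    exact: measurable_pospart.
  - by move=> y _; rewrite mule_ge0 ?pospart_ge0 ?invfp_ge0.
  rewrite (eq_integral (cst 1%E)); last first.
    move=> y; rewrite inE => -[xy /not_andP[]// /negP]; rewrite -ltNge => f0.
    rewrite /pospart /invfp f0 (max_idPl (ltW f0)).
    by rewrite -EFinM divff// gt_eqF.
  rewrite -(ge0_negligible_integral mN (measurable_cc _ _))//.
  by rewrite (integral_cst _ (measurable_cc _ _))/= mul1e lebesgue_cc.
have -> : (\int[leb]_(s in cc 0 T) pospart (-%R \o (f \o x)) s = 0)%E.
  transitivity (\int[leb]_(s in cc 0 T) pospart (-%R \o f) (x s))%E => //.
  rewrite (ge0_integral_time (measurable_pospart mfN)); last exact: pospart_ge0.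
  rewrite (ge0_integral_mu0 _ mZ)//; last 3 first.
  - by apply: measurable_funTS; exact: measurable_pospart.
  - by move=> y _; exact: pospart_ge0.
  - by move=> y _ /= /contrapT fy; rewrite /pospart/= fy oppr0 maxxx.
  rewrite add0e (ge0_integral_mu0 _ mN)//.
  - apply: measurable_funTS; apply: emeasurable_funM => //.
    exact: measurable_pospart.
  - by move=> y _; rewrite mule_ge0 ?pospart_ge0 ?invfp_ge0.
  - move=> y xy /not_andP[]// /negP; rewrite -ltNge => f0.
    by rewrite /pospart/= (max_idPr _) ?mul0e// oppr_le0 ltW.
by rewrite sube0.
Qed.

End pushforward_of_time.

End time_change.

Lemma ereal_between (R : realType) (a b : \bar R) : (a < b)%E ->
  exists z : R, (a < z%:E < b)%E.
Proof.
case: a => [a| |]; case: b => [b| |] //.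
- rewrite lte_fin => ab; exists ((a + b) / 2); rewrite !lte_fin.
  by apply/andP; split; lra.
- by move=> _; exists (a + 1); rewrite lte_fin ltry andbT; lra.
- by move=> _; exists (b - 1); rewrite lte_fin ltNyr/=; lra.
- by move=> _; exists 0; rewrite ltNyr ltry.
Qed.

(** * Maximal domains of increase and their endpoints *)

Section domains_of_increase.
Context {R : realType}.
Variables (f : R -> R) (mf : measurable_fun setT f).
Variables (M : R) (fM : forall x, `|f x| <= M).
Variable mu : {measure set (RB R) -> \bar R}.
Hypothesis mu1 : forall x, mu [set x] = 0%E.
Variable Sg : set R.
Implicit Types (a b : \bar R) (c d e x y z : R).
Local Notation leb := (@lebesgue_measure R).
Local Notation m := (hitm mf mu).

(** The working form: the inclusion of segments becomes a pair of inequalities on their endpoints.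
    Empty segments, included in every interval, have measure 0. *)
Lemma dom_incP a b : dom_inc f mu Sg a b <->
  [/\ (a < b)%E, forall x, (a < x%:E < b)%E -> ~ Sg x &
    forall c d, c <= d -> (a < c%:E)%E -> (d%:E < b)%E -> (m (cc c d) < +oo)%E].
Proof.
split.
  move=> [ab [abS abm]]; split => //.
    move=> x xab Sx; suff : (oo_int a b `&` Sg) x by rewrite abS.
    by split.
  move=> c d cd ac db; rewrite hitmE; apply: abm => x /ccP/andP[cx xd].
  by rewrite /oo_int/= (lt_le_trans ac) ?lee_fin//= (le_lt_trans _ db)// lee_fin.
move=> [ab abS abm]; split => //; split.
  by apply/seteqP; split => // x [xab]; exact: abS.
move=> c d cdab; rewrite -[X in (X < _)%E]hitmE.
have [cd|dc] := leP c d.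
  apply: abm => //.
    by have /(_ _)/andP[|] := cdab c => //; apply/ccP; rewrite lexx.
  by have /(_ _)/andP[|] := cdab d => //; apply/ccP; rewrite lexx andbT.
by rewrite /cc set_itv_ge ?measure0// bnd_simp -ltNge.
Qed.

Lemma hitm_cc_lty c x d : c <= x -> x <= d -> (m (cc c x) < +oo)%E ->
  (m (cc x d) < +oo)%E -> (m (cc c d) < +oo)%E.
Proof. by move=> cx xd *; rewrite (hitm_cc_split mf (mu1 x) cx xd) lte_add_pinfty. Qed.

Lemma dom_inc_merge a b a' b' z : dom_inc f mu Sg a b -> dom_inc f mu Sg a' b' ->
  (a < z%:E < b)%E -> (a' < z%:E < b')%E ->
  dom_inc f mu Sg (Order.min a a') (Order.max b b').
Proof.
move=> /dom_incP[ab abS abm] /dom_incP[ab' abS' abm'] /andP[az zb] /andP[az' zb'].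
apply/dom_incP; split.
- by rewrite (@lt_trans _ _ z%:E)// ?gt_min ?lt_max ?az ?zb.
- move=> x; rewrite gt_min lt_max => /andP[ax xb].
  have [xz|zx] := leP x z.
    move: ax => /orP[ax|ax]; [apply: abS|apply: abS'];
    by rewrite ax/= (@le_lt_trans _ _ z%:E)// lee_fin.
  move: xb => /orP[xb|xb]; [apply: abS|apply: abS'];
  by rewrite xb/= andbT (@lt_trans _ _ z%:E)// lte_fin.
- move=> c d cd; rewrite gt_min lt_max => ac db.
  (* Enlarging the segment so that it contains [z] allows cutting it at [z] into two pieces, each
     inside one of the two domains. *)
  apply: (@le_lt_trans _ _ (m (cc (Num.min c z) (Num.max d z)))).
    by apply: le_measure_cc; rewrite ?ge_min ?le_max lexx.
  apply: (@hitm_cc_lty _ z); rewrite ?ge_min ?le_max ?lexx ?orbT//.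
    have mz : Num.min c z <= z by rewrite ge_min lexx orbT.
    by move: ac => /orP[ac|ac]; [apply: abm|apply: abm'] => //;
      rewrite /Num.min; case: ifPn.
  have zm : z <= Num.max d z by rewrite le_max lexx orbT.
  by move: db => /orP[db|db]; [apply: abm|apply: abm'] => //;
    rewrite /Num.max; case: ifPn.
Qed.

Lemma oo_int_subP a b a' b' : (a < b)%E -> oo_int a b `<=` oo_int a' b' ->
  (a' <= a)%E /\ (b <= b')%E.
Proof.
move=> ab sub; split; rewrite leNgt; apply/negP => h.
  have [z /andP[az]] : exists z, (a < z%:E < Order.min a' b)%E.
    by apply: ereal_between; rewrite lt_min h.
  rewrite lt_min => /andP[za' zb]; have /andP[] := sub z ltac:(exact/andP).
  by move=> /lt_trans/(_ za'); rewrite ltxx.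
have [z /andP[+ zb]] : exists z, (Order.max a b' < z%:E < b)%E.
  by apply: ereal_between; rewrite gt_max ab.
rewrite gt_max => /andP[az bz]; have /andP[] := sub z ltac:(exact/andP).
by move=> _ /lt_trans/(_ bz); rewrite ltxx.
Qed.

Lemma sub_oo_int a b a' b' : (a' <= a)%E -> (b <= b')%E ->
  oo_int a b `<=` oo_int a' b'.
Proof.
move=> aa bb x /andP[ax xb]; rewrite /oo_int/= (le_lt_trans aa ax)/=.
exact: lt_le_trans bb.
Qed.

Lemma max_dom_inc_ge a b a' b' z : max_dom_inc f mu Sg a b ->
  dom_inc f mu Sg a' b' -> (a < z%:E < b)%E -> (a' < z%:E < b')%E ->
  (a <= a')%E /\ (b' <= b)%E.
Proof.
move=> [ab abmax] ab' zab zab'.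
have [|am bm] := abmax _ _ (dom_inc_merge ab ab' zab zab').
  by apply: sub_oo_int; rewrite ?ge_min ?le_max lexx.
by split; [rewrite -am ge_min|rewrite -bm le_max]; rewrite lexx orbT.
Qed.

(** The union of all domains through a fixed point [z] of []a0, b0[] is a domain: any two points of
    it already lie in the merger of two domains. *)
Lemma max_dom_inc_exists a0 b0 : dom_inc f mu Sg a0 b0 ->
  exists a b, [/\ max_dom_inc f mu Sg a b, (a <= a0)%E & (b0 <= b)%E].
Proof.
move=> ab0; have [/ereal_between[z /andP[az zb]] _ _] := (dom_incP _ _).1 ab0.
pose P (p : \bar R * \bar R) := dom_inc f mu Sg p.1 p.2 /\ (p.1 < z%:E < p.2)%E.
pose a := ereal_inf [set p.1 | p in P]; pose b := ereal_sup [set p.2 | p in P].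
have P0 : P (a0, b0) by split=> //=; rewrite az.
have aP p : P p -> (a <= p.1)%E by move=> Pp; apply: ereal_inf_lbound; exists p.
have bP p : P p -> (p.2 <= b)%E by move=> Pp; apply: ereal_sup_ubound; exists p.
have azb : (a < z%:E < b)%E.
  by rewrite (le_lt_trans (aP _ P0))//= (lt_le_trans _ (bP _ P0)).
have abD c d : (a < c%:E)%E -> (d%:E < b)%E ->
    exists p, [/\ P p, (p.1 < c%:E)%E & (d%:E < p.2)%E].
  move=> /ereal_inf_lt[_ [p Pp <-] pc] /ereal_sup_gt[_ [q Qq <-] dq].
  exists (Order.min p.1 q.1, Order.max p.2 q.2); split => /=.
  - split; first exact: (dom_inc_merge Pp.1 Qq.1 Pp.2 Qq.2).
    by rewrite gt_min lt_max (andP Pp.2).1 (andP Pp.2).2.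
  - by rewrite gt_min pc.
  - by rewrite lt_max dq orbT.
have abdom : dom_inc f mu Sg a b.
  apply/dom_incP; split.
  - by have /andP[/lt_trans] := azb; apply.
  - move=> x /andP[/abD/[apply]] [p [[/dom_incP[_ pS _] _] px xp]].
    by apply: pS; rewrite px.
  - by move=> c d cd /abD/[apply] -[p [[/dom_incP[_ _ +] _] pc dp]]; exact.
exists a, b; split; [split => // a' b' ab' sub|exact: aP P0|exact: bP P0].
have [aa bb] := oo_int_subP ltac:(by have /andP[/lt_trans] := azb; apply) sub.
have zab' := sub z azb.
have P' : P (a', b') by [].
by split; apply/eqP; rewrite eq_le ?aa ?bb ?(aP _ P') ?(bP _ P').
Qed.

Lemma in_Iplus_intro x b0 e : dom_inc f mu Sg x%:E b0 -> ~ Sg x -> 0 < e ->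
  (m (cc x (x + e)) < +oo)%E -> in_Iplus f mu Sg x.
Proof.
move=> xb Sx e0 mx; have [a [b [abmax ax b0b]]] := max_dom_inc_exists xb.
exists a, b; split => //.
move: ax; rewrite le_eqVlt => /predU1P[ax|ax]; last first.
  left; rewrite /oo_int/= ax/=; apply: lt_le_trans b0b.
  by have [] := (dom_incP _ _).1 xb.
by right; split=> //; split => //; exists e => //; rewrite -[X in (X < _)%E]hitmE.
Qed.

(** Interior points and an admissible left endpoint behave alike from here on: the time is finite
    counting from [x] itself. *)
Lemma Iplus_lty a b x : dom_inc f mu Sg a b -> Iplus f mu Sg a b x ->
  [/\ (a <= x%:E)%E, (x%:E < b)%E, ~ Sg x &
    forall d, (d%:E < b)%E -> (m (cc x d) < +oo)%E].
Proof.
move=> /dom_incP[ab abS abm].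
have hd d : d < x -> (m (cc x d) < +oo)%E.
  by move=> dx; rewrite /cc set_itv_ge ?measure0// bnd_simp -ltNge.
move=> [/andP[ax xb]|[ax [Sx [e e0]]]].
  split => //; [exact: ltW|by apply: abS; rewrite ax|].
  by move=> d db; have [xd|] := leP x d; [exact: abm|exact: hd].
rewrite -[X in (X < _)%E]hitmE => xe; split => //; [by rewrite ax|by rewrite -ax|].
move=> d db; have [dx|dx] := leP d (x + e).
  by apply: le_lt_trans xe; exact: le_measure_cc.
apply: (@hitm_cc_lty x (x + e)) => //; [lra|exact: ltW|].
by apply: abm => //; [exact: ltW|rewrite ax lte_fin; lra].
Qed.

(** If [y], reached in finite time, could also be left to the right, a domain of increase would
    extend across [y], against maximality. *)
Lemma end_not_Iplus a x0 y : max_dom_inc f mu Sg a y%:E -> (a <= x0%:E)%E ->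
  x0 < y -> (m (cc x0 y) < +oo)%E -> ~ in_Iplus f mu Sg y.
Proof.
move=> aymax ax x0y mxy [a' [b' [max' yI]]].
have [dom' _] := max'; have [ay yb Sy yd] := Iplus_lty dom' yI.
have [/dom_incP[_ ayS aym] _] := aymax.
have [_ dom'S dom'm] := (dom_incP _ _).1 dom'.
have xb : dom_inc f mu Sg x0%:E b'.
  apply/dom_incP; split.
  - by apply: lt_trans yb; rewrite lte_fin.
  - move=> x /andP[xx xb]; have [xy|yx|->//] := ltgtP x y.
      by apply: ayS; rewrite lte_fin xy (le_lt_trans ax).
    by apply: dom'S; rewrite xb (le_lt_trans ay)// lte_fin.
  - move=> c d cd; rewrite lte_fin => xc db.
    apply: (@le_lt_trans _ _ (m (cc x0 (Num.max y d)))).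
      by apply: le_measure_cc; [exact: ltW|rewrite le_max lexx orbT].
    apply: (@hitm_cc_lty _ y) => //; [exact: ltW|by rewrite le_max lexx|].
    by apply: yd; rewrite /Num.max; case: ifPn.
have [z /andP[xz zy]] : exists z, (x0%:E < z%:E < y%:E)%E.
  by apply: ereal_between; rewrite lte_fin.
have [] := max_dom_inc_ge aymax xb (z := z).
- by rewrite zy (le_lt_trans ax).
- by rewrite xz (lt_trans zy).
by move=> _; rewrite leNgt yb.
Qed.

Lemma invfmE y : invfm f y = (- invfp (-%R \o f) y)%E.
Proof.
rewrite /invfm /invfp/= oppr_gt0; case: ifPn => // _.
by rewrite -EFinN invrN opprK.
Qed.

Lemma intcc_invfm c d : intcc c d (invfm f) = (- intcc c d (invfp (-%R \o f)))%E.
Proof.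
rewrite /intcc -integral_ge0N//; last by move=> *; exact: invfp_ge0.
by apply: eq_integral => y _; exact: invfmE.
Qed.

Let mfN : measurable_fun setT (-%R \o f).
Proof. exact: measurableT_comp. Qed.

Lemma invfp_invfm_disjoint c d : c < d -> (intcc c d (invfp f) < +oo)%E ->
  (- intcc c d (invfm f) < +oo)%E -> False.
Proof.
rewrite intcc_invfm oppeK => cd fp fm.
have h1 := invfp_lty_pos mf (measurable_cc c d) fp.
have h2 := invfp_lty_pos mfN (measurable_cc c d) fm.
have : (leb (cc c d) <= leb (cc c d `&` [set x | (f x <= 0)%R]) +
    leb (cc c d `&` [set x | ((-%R \o f) x <= 0)%R]))%E.
  have mle (g : R -> R) : measurable_fun setT g ->
      measurable (cc c d `&` [set x | g x <= 0] : set (RB R)).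
    move=> mg; apply: measurableI => //; rewrite -[X in measurable X]setTI.
    exact: measurable_fun_le.
  apply: le_trans (measureU2 leb (mle _ mf) (mle _ mfN)).
  rewrite le_measure ?inE//; first by apply: measurableU; exact: mle.
  move=> x xcd; have [fx|fx] := leP (f x) 0; [by left|right; split => //=].
  by rewrite oppr_le0 ltW.
rewrite h1 h2 adde0 lebesgue_cc; last exact: ltW.
by move=> h; have : d - c <= 0 by []; lra.
Qed.

Lemma intcc_invfp_le c d c' d' : c' <= c -> d <= d' ->
  (intcc c d (invfp f) <= intcc c' d' (invfp f))%E.
Proof.
move=> cc' dd'; apply: ge0_subset_integral => //.
- by apply: measurable_funTS; exact: measurable_invfp.
- by move=> *; exact: invfp_ge0.
- exact: subset_cc.
Qed.

(** Leaving [x] to the left in finite time needs [f < 0] almost everywhere just left of [x], whereas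
    the hypothesis gives [f > 0] almost everywhere there. *)
Lemma left_lty_not_Iminus x e : 0 < e -> (intcc (x - e) x (invfp f) < +oo)%E ->
  ~ in_Iminus f mu Sg x.
Proof.
move=> e0 xe [a [b [[[ab [_ abm]] _] xI]]].
have [e' e'0 xe'] : exists2 e', 0 < e' & (- intcc (x - e') x (invfm f) < +oo)%E.
  have D0 (e' : R) : (mu (cc (x - e') x) - intcc (x - e') x (invfm f) < +oo)%E ->
      (- intcc (x - e') x (invfm f) < +oo)%E.
    by apply: le_lt_trans; rewrite leeDr.
  move: xI => [/andP[ax xb]|[_ [_ [e' e'0 /D0 ?]]]]; last by exists e'.
  have [z /andP[az zx]] := ereal_between ax; rewrite lte_fin in zx.
  exists (x - z); first by rewrite subr_gt0.
  apply: D0; apply: abm => y /ccP/andP[zy yx]; rewrite /oo_int/=.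
  rewrite (lt_le_trans az) ?lee_fin//=; last by move: zy; lra.
  by rewrite (le_lt_trans _ xb)// lee_fin.
pose d := Num.min e e'.
have d0 : 0 < d by rewrite lt_min e0.
have de : d <= e by rewrite ge_min lexx.
have de' : d <= e' by rewrite ge_min lexx orbT.
apply: (@invfp_invfm_disjoint (x - d) x); first lra.
  by apply: le_lt_trans xe; apply: intcc_invfp_le => //; lra.
apply: le_lt_trans xe'; rewrite !intcc_invfm !oppeK.
apply: ge0_subset_integral => //.
- by apply: measurable_funTS; exact: measurable_invfp.
- by move=> *; exact: invfp_ge0.
- by apply: subset_cc => //; lra.
Qed.

End domains_of_increase.

(** * The flow on a domain of increase *)

Section increasing_flow.
Context {R : realType}.
Variables (f : R -> R) (mf : measurable_fun setT f).
Variables (M : R) (fM : forall x, `|f x| <= M).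
Variable mu : {measure set (RB R) -> \bar R}.
Hypothesis mu1 : forall x, mu [set x] = 0%E.
Hypothesis muf : mu (~` (f @^-1` [set 0])) = 0%E.
Variable Sg : set R.
Implicit Types (a b : \bar R) (c d e x y z : R).
Local Notation leb := (@lebesgue_measure R).
Local Notation m := (hitm mf mu).

(** Near [x] on the right, [1/f] is bounded by [1/dl], and neither [mu] nor [Sg] meets the set where
    [f] is nonzero. *)
Lemma in_Iplus_right_pos x e dl : Sg `<=` f @^-1` [set 0] -> f x != 0 ->
  0 < e -> 0 < dl -> (forall z, x < z < x + e -> dl <= f z) ->
  in_Iplus f mu Sg x.
Proof.
move=> Sgf fx e0 dl0 fz.
have Sx : ~ Sg x by move=> /Sgf /eqP; exact/negP.
have mxd d : d < x + e -> (m (cc x d) < +oo)%E.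
  move=> dx; have [dx'|xd] := ltP d x.
    by rewrite /cc set_itv_ge ?measure0// bnd_simp -ltNge.
  have mN : measurable (~` (f @^-1` [set 0]) : set (RB R)).
    by apply: measurableC; rewrite -[X in measurable X]setTI; exact: mf.
  rewrite hitmE (_ : mu _ = 0%E) ?add0e; last first.
    apply/eqP; rewrite eq_le measure_ge0 andbT -muf le_measure ?inE//.
    move=> z /ccP/andP[xz zd] /= fz0.
    move: xz fx; rewrite le_eqVlt => /predU1P[->|xz]; first by rewrite fz0 eqxx.
    by have := fz z ltac:(by apply/andP; split; lra); rewrite fz0; lra.
  (* At [x] itself [f] may be negative and [invfp] infinite, so this null point is removed first. *)
  have mx : measurable ([set x] : set (RB R)) by [].
  rewrite (ge0_negligible_integral mx (measurable_cc x d))//; last 3 first.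
  - by apply: measurable_funTS; exact: measurable_invfp.
  - by move=> *; exact: invfp_ge0.
  - exact: lebesgue_measure_set1.
  apply: (@le_lt_trans _ _ (\int[leb]_(z in cc x d `\` [set x]) (dl^-1)%:E)%E).
    apply: ge0_le_integral => //.
    - exact: measurableD.
    - by move=> *; exact: invfp_ge0.
    - by apply: measurable_funTS; exact: measurable_invfp.
    - move=> z [/ccP/andP[xz zd] /eqP zx].
      have dlf : dl <= f z.
        by apply: fz; rewrite lt_neqAle eq_sym zx xz/=; exact: le_lt_trans dx.
      rewrite /invfp (lt_le_trans dl0 dlf) lee_fin lef_pV2// posrE//.
      exact: lt_le_trans dlf.
  rewrite integral_cst//; last exact: measurableD.
  rewrite lte_mul_pinfty// ?lee_fin ?invr_ge0 ?ltW//=.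
  apply: (@le_lt_trans _ _ (leb (cc x d))).
    rewrite le_measure ?inE//; exact: measurableD.
  by rewrite lebesgue_cc// ltry.
apply: (@in_Iplus_intro _ _ mf mu mu1 _ x (x + e)%:E (e / 2)) => //; last 2 first.
- by rewrite divr_gt0.
- by apply: mxd; lra.
apply/(dom_incP mf); split.
- by rewrite lte_fin; lra.
- move=> y; rewrite !lte_fin => xye /Sgf/= fy.
  by have := fz y xye; rewrite fy; lra.
- move=> c d cd; rewrite !lte_fin => xc dx.
  by apply: le_lt_trans (mxd d dx); apply: le_measure_cc => //; exact: ltW.
Qed.

Lemma co_int_fin x y : co_int x y%:E = cc x y.
Proof.
apply/seteqP; split => z; first by move=> [xz zy]; apply/ccP; rewrite xz -lee_fin.
by move=> /ccP/andP[xz zy]; split; rewrite ?lee_fin.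
Qed.

Lemma measurable_co_int x b : measurable (co_int x b).
Proof.
case: b => [b| |].
- by rewrite co_int_fin.
- rewrite (_ : co_int x _ = `[x, +oo[%classic)//; apply/seteqP; split => y.
    by move=> [xy _]; rewrite /= in_itv/= xy.
  by rewrite /= in_itv/= andbT => xy; split; rewrite ?leey.
- rewrite (_ : co_int x _ = set0)//; apply/seteqP; split => y // [_].
  by rewrite leeNy_eq.
Qed.
Hint Resolve measurable_co_int : core.

Lemma FplusE x b : Fplus f mu x b = m (co_int x b).
Proof. by rewrite hitmE. Qed.

Lemma Fplus_fin x y : Fplus f mu x y%:E = m (cc x y).
Proof. by rewrite FplusE co_int_fin. Qed.

Lemma le_Fplus x y b : (y%:E <= b)%E -> (m (cc x y) <= Fplus f mu x b)%E.
Proof.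
move=> yb; rewrite FplusE le_measure ?inE//.
by move=> z /ccP/andP[xz zy]; split => //; apply: le_trans yb; rewrite lee_fin.
Qed.

Lemma Fplus_split x y b : x <= y -> (y%:E <= b)%E ->
  Fplus f mu x b = (m (cc x y) + Fplus f mu y b)%E.
Proof.
move=> xy yb; rewrite !FplusE.
have -> : co_int x b = cc x y `|` (co_int y b `\` [set y]).
  apply/seteqP; split => z.
    move=> [xz zb]; have [zy|yz] := leP z y; first by left; apply/ccP; rewrite xz.
    by right; split; [split => //; exact: ltW|move=> /= zy; rewrite zy ltxx in yz].
  move=> [/ccP/andP[xz zy]|[[yz zb] _]]; split => //.
    by apply: le_trans yb; rewrite lee_fin.
  exact: le_trans yz.
rewrite measureU//; last 2 first.
- exact: measurableD.
- apply/seteqP; split => z // [/ccP/andP[_ zy] [[yz _]]]; apply.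
  by apply/eqP; rewrite eq_le zy.
congr (_ + _)%E; have yyb : [set y] `<=` co_int y b by move=> _ ->; split.
rewrite -[in RHS](setDUK yyb) measureU//.
- by rewrite [X in (X + _)%E](hitm_set1 mf (mu1 y)) add0e.
- exact: measurableD.
- by rewrite setIDA setIC -setIDA setDv setI0.
Qed.

Lemma Fplus_gt0 x b : (x%:E < b)%E -> (0 < Fplus f mu x b)%E.
Proof.
move=> /ereal_between[y /andP[]]; rewrite lte_fin => xy yb.
apply: lt_le_trans (le_Fplus x (ltW yb)).
apply: lt_le_trans (hitm_cc_ge mf fM mu (ltW xy)).
by rewrite lte_fin divr_gt0//; have := le_trans (normr_ge0 _) (fM 0); lra.
Qed.

Lemma hitm_cc_inj x y z : x <= y -> x <= z -> m (cc x y) = m (cc x z) ->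
  (m (cc x y) < +oo)%E -> y = z.
Proof.
move=> xy xz yz yoo; apply/eqP; rewrite eq_le !leNgt.
apply/andP; split; apply/negP => h.
- by have := hitm_cc_lt (mf := mf) fM xz h (mu1 z); rewrite -yz ltxx => /(_ yoo).
- by have := hitm_cc_lt (mf := mf) fM xy h (mu1 y); rewrite yz ltxx -yz => /(_ yoo).
Qed.

Section trajectory.
Variables (a b : \bar R) (x0 : R).
Hypothesis abmax : max_dom_inc f mu Sg a b.
Hypothesis x0I : Iplus f mu Sg a b x0.

Let tau := Fplus f mu x0 b.

Let x0b : [/\ (a <= x0%:E)%E, (x0%:E < b)%E, ~ Sg x0 &
    forall d, (d%:E < b)%E -> (m (cc x0 d) < +oo)%E].
Proof. exact: (Iplus_lty mf mu1 abmax.1 x0I). Qed.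

(** Bounded speed makes the end finite. It can be left neither to the right, by maximality, nor to
    the left, as [f > 0] almost everywhere on the segment just travelled. So the constructed motion
    rests there. *)
Lemma finite_end : (tau < +oo)%E -> exists2 be, b = be%:E &
  [/\ (m (cc x0 be) < +oo)%E, ~ in_Iplus f mu Sg be & ~ in_Iminus f mu Sg be].
Proof.
have [ax xb Sx xd] := x0b; move=> tauoo.
have M0 : 0 < M + 1 by have := le_trans (normr_ge0 _) (fM 0); lra.
case: b @tau xb abmax tauoo => [be| |] //.
  rewrite /= lte_fin Fplus_fin => xbe abmax' xoo; exists be => //; split => //.
    exact: (end_not_Iplus mu1 abmax' ax xbe xoo).
  apply: (@left_lty_not_Iminus _ _ mf _ _ _ (be - x0)); first lra.
  by rewrite subKr; exact: (hitm_lty (measurable_cc _ _) xoo).2.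
move=> /= xb _ tauoo; exfalso.
have tau0 : (0 <= Fplus f mu x0 +oo)%E by exact/ltW/Fplus_gt0.
pose t := fine (Fplus f mu x0 +oo).
have tE : Fplus f mu x0 +oo = t%:E by rewrite /t fineK// ge0_fin_numE.
have t0 : 0 <= t by rewrite -lee_fin -tE.
(* At speed at most [M + 1], reaching [y] takes at least [t + 1], more than the supposed total time
   [t]. *)
pose y := x0 + (t + 1) * (M + 1).
have y0 : 0 < (t + 1) * (M + 1) by rewrite mulr_gt0//; lra.
have := le_trans (hitm_cc_ge mf fM mu (c := x0) (d := y) ltac:(rewrite /y; lra))
  (le_Fplus x0 (leey y%:E)).
by rewrite tE lee_fin /y addrAC subrr add0r mulfK ?gt_eqF//; lra.
Qed.

Variable X : R -> R.
Hypothesis XP : forall t, 0 <= t -> Splus_spec f mu Sg x0 t (X t).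

Let X_lt t : 0 <= t -> (t%:E < tau)%E ->
  [/\ x0 <= X t, ((X t)%:E < b)%E & m (cc x0 (X t)) = t%:E].
Proof.
move=> t0 ttau; have [/(_ ttau)] := XP t0 abmax x0I.
by rewrite Fplus_fin => -[? []].
Qed.

Let X_ge t : 0 <= t -> (tau <= t%:E)%E -> (X t)%:E = b.
Proof. by move=> t0 ttau; have [_ /(_ ttau)] := XP t0 abmax x0I. Qed.

Lemma Splus0 : X 0 = x0.
Proof.
have [_ xb _ xd] := x0b.
have [|xX _ X0] := X_lt (lexx 0); first exact: Fplus_gt0.
have m0 : m (cc x0 x0) = 0%E by rewrite /cc set_itv1; exact: hitm_set1.
by apply: (hitm_cc_inj xX (lexx _)); rewrite X0 ?m0 ?ltry.
Qed.

Lemma Splus_caratheodory : (forall be, b = be%:E -> (tau < +oo)%E -> f be = 0) ->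
  caratheodory f x0 X.
Proof.
move=> fb t t0; have [ttau|taut] := ltP t%:E tau.
  apply: (inverse_caratheodory fM mu1 muf t0) => s /andP[s0 st].
  have [|? ? ?] := X_lt s0; last by split.
  by apply: le_lt_trans ttau; rewrite lee_fin.
have tauoo : (tau < +oo)%E by apply: le_lt_trans taut (ltry _).
have [be bE [mbe _ _]] := finite_end tauoo.
have tau0 : (0 <= tau)%E by rewrite /tau FplusE.
have [T TE] : exists T, tau = T%:E.
  by exists (fine tau); rewrite fineK// ge0_fin_numE.
have T0 : 0 <= T by rewrite -lee_fin -TE.
have Tt : T <= t by rewrite -lee_fin -TE.
have XT s : T <= s -> X s = be.
  move=> Ts; have := X_ge (le_trans T0 Ts); rewrite TE lee_fin => /(_ Ts).
  by rewrite bE => -[].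
have [|XTi XTE] := @inverse_caratheodory _ _ mf _ fM _ mu1 muf x0 T X T0.
  move=> s /andP[s0]; rewrite le_eqVlt => /predU1P[->|sT].
    rewrite XT// -TE /tau bE Fplus_fin; split => //.
    by have [_] := x0b; rewrite bE lte_fin => /ltW.
  by have [|? ? ?] := X_lt s0; [rewrite TE lte_fin|split].
(* After the arrival time [T] the trajectory rests at a zero of [f], so the integrals up to [t] and
   up to [T] have the same integrand once extended by 0. *)
have E : (fun s => (f (X s))%:E) \_ (cc 0 t) = (fun s => (f (X s))%:E) \_ (cc 0 T).
  apply/funext => s; rewrite !patchE.
  case: ifPn => [/set_mem/ccP/andP[s0 st]|st];
    case: ifPn => [/set_mem/ccP/andP[s0' sT]|sT] //.
    rewrite XT ?fb// leNgt; apply: contra sT => sT.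
    by apply/mem_set/ccP; rewrite s0 ltW.
  by move/negP: st; case; apply/mem_set/ccP; rewrite s0' (le_trans sT).
split.
  by rewrite integrable_mkcond// E -integrable_mkcond.
by rewrite integral_mkcond E -integral_mkcond -XTE !XT.
Qed.

End trajectory.

(** Hitting times add up along consecutive segments, and a position is determined by its hitting
    time. After a positive time the point is interior or has arrived at [b], so the rule for [S] is
    required just there. *)
Lemma Splus_semigroup a b x0 (S : R -> R -> R) : max_dom_inc f mu Sg a b ->
  Iplus f mu Sg a b x0 -> (forall t, 0 <= t -> Splus_spec f mu Sg x0 t (S x0 t)) ->
  (forall y t, oo_int a b y -> 0 <= t -> Splus_spec f mu Sg y t (S y t)) ->
  (forall be t, b = be%:E -> (Fplus f mu x0 b < +oo)%E -> 0 <= t -> S be t = be) ->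
  forall s t, 0 <= s -> 0 <= t -> S (S x0 s) t = S x0 (t + s).
Proof.
move=> abmax x0I x0S yS bS s t s0 t0.
have [ax xb _ xd] := Iplus_lty mf mu1 abmax.1 x0I.
move: s0; rewrite le_eqVlt => /predU1P[<-|s0].
  by rewrite addr0 (Splus0 abmax x0I x0S).
have ts0 : 0 <= t + s by lra.
have [s_lt s_ge] := x0S s (ltW s0) a b abmax x0I.
have [ts_lt ts_ge] := x0S (t + s) ts0 a b abmax x0I.
have [staus|staus] := ltP s%:E (Fplus f mu x0 b); last first.
  have be := s_ge staus.
  have tauoo : (Fplus f mu x0 b < +oo)%E by apply: le_lt_trans staus (ltry _).
  rewrite (bS (S x0 s) t (esym be) tauoo t0).
  have /ts_ge : (Fplus f mu x0 b <= (t + s)%:E)%E.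
    by apply: le_trans staus _; rewrite lee_fin; lra.
  by rewrite -be => -[->].
have [xX [Xb XE]] := s_lt staus; rewrite Fplus_fin in XE.
have xX' : x0 < S x0 s.
  rewrite lt_neqAle xX andbT; apply/eqP => xE; move: XE; rewrite -xE /cc set_itv1.
  by rewrite hitm_set1// => -[] ?; lra.
set y := S x0 s in xX Xb XE xX' *.
have yab : oo_int a b y by rewrite /oo_int/= Xb (le_lt_trans ax)// lte_fin.
have [y_lt y_ge] := yS y t yab t0 a b abmax (or_introl yab).
have tauE := Fplus_split xX (ltW Xb); rewrite XE in tauE.
have [tty|tty] := ltP t%:E (Fplus f mu y b); last first.
  have /ts_ge tsb : (Fplus f mu x0 b <= (t + s)%:E)%E.
    by rewrite tauE addrC EFinD leeD.
  by have /= := y_ge tty; rewrite -tsb => -[].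
have [yY [Yb YE]] := y_lt tty; rewrite Fplus_fin in YE.
have [|xZ [Zb ZE]] := ts_lt.
  by rewrite tauE addrC EFinD lteD2lE.
rewrite Fplus_fin in ZE.
apply: (@hitm_cc_inj x0) => //.
- exact: le_trans yY.
- by rewrite (hitm_cc_split mf (mu1 y) xX yY) XE YE ZE -EFinD addrC.
- by rewrite (hitm_cc_split mf (mu1 y) xX yY) XE YE -EFinD ltry.
Qed.

End increasing_flow.

(** * The reflection exchanging increase and decrease *)

Section reflection.
Context {R : realType}.
Implicit Types (f : R -> R) (mu : {measure set (RB R) -> \bar R}) (Sg : set R).
Implicit Types (a b : \bar R) (c d e x y z t : R) (A : set (RB R)).
Local Notation leb := (@lebesgue_measure R).

(** The vector field followed by [- x] when [x] follows [f]. *)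
Definition refl f : R -> R := fun y => - f (- y).

Lemma reflK f : refl (refl f) = f.
Proof. by apply/funext => y; rewrite /refl !opprK. Qed.

Lemma measurable_refl f : measurable_fun setT f -> measurable_fun setT (refl f).
Proof.
move=> mf; rewrite (_ : refl f = -%R \o (f \o -%R))//.
by do 2 apply: measurableT_comp => //.
Qed.

Lemma refl_bound f M : (forall x, `|f x| <= M) -> forall x, `|refl f x| <= M.
Proof. by move=> fM x; rewrite /refl normrN. Qed.

Lemma measurable_oppRB : measurable_fun setT (-%R : RB R -> RB R).
Proof. exact: measurable_funN. Qed.

Definition mrefl mu : {measure set (RB R) -> \bar R} := mpush measurable_oppRB mu.

Lemma mreflE mu A : mrefl mu A = mu [set y | A (- y)]. Proof. by []. Qed.

Lemma mreflK mu : mrefl (mrefl mu) = mu.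
Proof.
apply: eq_measure; apply/funext => A; rewrite !mreflE; congr (mu _).
by apply/seteqP; split => y /=; rewrite opprK.
Qed.

Definition srefl Sg : set R := [set x | Sg (- x)].

Lemma sreflK Sg : srefl (srefl Sg) = Sg.
Proof. by apply/seteqP; split => y; rewrite /srefl/= opprK. Qed.

Lemma cc_opp c d : [set y | cc c d (- y)] = cc (- d) (- c).
Proof. by apply/seteqP; split => y /ccP h; apply/ccP; move: h; rewrite lerNl lerNr andbC. Qed.

Lemma mrefl_cc mu c d : mrefl mu (cc c d) = mu (cc (- d) (- c)).
Proof. by rewrite mreflE cc_opp. Qed.

Lemma ge0_integral_oppr A (h : R -> \bar R) : measurable A ->
  measurable_fun setT (h : RB R -> \bar R) -> (forall y, 0 <= h y)%E ->
  (\int[leb]_(y in A) h (- y)%R = \int[leb]_(y in [set y | A (- y)%R]) h y)%E.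
Proof.
move=> mA mh h0.
have mA' : measurable [set y | A (- y)].
  by rewrite -[X in measurable X]setTI; exact: measurable_oppRB.
transitivity (\int[mrefl leb]_(y in [set y | A (- y)%R]) h y)%E.
  rewrite ge0_integral_mpush//; last exact: measurable_funTS.
  by congr (integral _ _ _); apply/seteqP; split => y /=; rewrite opprK.
by apply: eq_measure_integral => B mB _; exact: lebesgue_measureN.
Qed.

Lemma invfp_refl f A : measurable_fun setT f -> measurable A ->
  (\int[leb]_(y in A) invfp (refl f) y =
   - \int[leb]_(y in [set y | A (- y)%R]) invfm f y)%E.
Proof.
move=> mf mA; pose h := invfp (-%R \o f).
have mfN : measurable_fun setT (-%R \o f) by exact: measurableT_comp.
transitivity (\int[leb]_(y in A) h (- y)%R)%E.
  by apply: eq_integral => y _; rewrite /h /invfp /refl/=.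
rewrite ge0_integral_oppr//; [|exact: measurable_invfp|exact: invfp_ge0].
under [X in _ = (- X)%E]eq_integral do rewrite invfmE.
by rewrite integral_ge0N ?oppeK// => *; exact: invfp_ge0.
Qed.

Lemma intcc_refl f c d : measurable_fun setT f ->
  intcc c d (invfp (refl f)) = (- intcc (- d) (- c) (invfm f))%E.
Proof. by move=> mf; rewrite /intcc invfp_refl// cc_opp. Qed.

Lemma oo_int_opp a b x : oo_int a b (- x) <-> oo_int (- b)%E (- a)%E x.
Proof. by rewrite /oo_int/= EFinN lteNr lteNl andbC. Qed.

Section refl_plus.
Variables (f : R -> R) (mu : {measure set (RB R) -> \bar R}) (Sg : set R).
Hypothesis mf : measurable_fun setT f.

Lemma dom_inc_refl a b : dom_inc (refl f) (mrefl mu) (srefl Sg) a b <->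
  dom_dec f mu Sg (- b)%E (- a)%E.
Proof.
split=> -[ab [abS abm]]; split; rewrite ?lteN2// in ab *; split.
- apply/seteqP; split => // x [xab Sx].
  suff : (oo_int a b `&` srefl Sg) (- x) by rewrite abS.
  by split; [exact/oo_int_opp|rewrite /srefl/= opprK].
- move=> c d cdab; have := abm (- d) (- c); rewrite intcc_refl// mrefl_cc !opprK; apply.
  move=> y ycd; rewrite -(opprK y); apply/oo_int_opp/cdab.
  by rewrite -[X in cc X]opprK -[X in cc _ X]opprK -cc_opp/= opprK.
- apply/seteqP; split => // x [xab Sx].
  suff : (oo_int (- b)%E (- a)%E `&` Sg) (- x) by rewrite abS.
  by split => //; apply/(oo_int_opp a b (- x)).1; rewrite opprK.
- move=> c d cdab; rewrite intcc_refl// mrefl_cc; apply: abm.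
  by move=> y; rewrite -cc_opp/= => /cdab/oo_int_opp.
Qed.

Lemma max_dom_inc_refl a b : max_dom_inc (refl f) (mrefl mu) (srefl Sg) a b <->
  max_dom_dec f mu Sg (- b)%E (- a)%E.
Proof.
have sub a' b' a2 b2 : oo_int a' b' `<=` oo_int a2 b2 ->
    oo_int (- b')%E (- a')%E `<=` oo_int (- b2)%E (- a2)%E.
  by move=> s y /oo_int_opp/s/oo_int_opp.
split=> -[abd abm]; split.
- exact/dom_inc_refl.
- move=> a' b' ab' /sub; rewrite !oppeK => s.
  have [|<- <-] := abm (- b')%E (- a')%E _ s; last by rewrite !oppeK.
  by apply/dom_inc_refl; rewrite !oppeK.
- exact/dom_inc_refl.
- move=> a' b' /dom_inc_refl ab' /sub s.
  by have [/oppe_inj ? /oppe_inj ?] := abm _ _ ab' s.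
Qed.

Lemma Iplus_refl a b x : Iplus (refl f) (mrefl mu) (srefl Sg) a b x <->
  Iminus f mu Sg (- b)%E (- a)%E (- x).
Proof.
have E e : (mrefl mu (cc x (x + e)) + intcc x (x + e) (invfp (refl f)) =
    mu (cc (- x - e) (- x)) - intcc (- x - e) (- x) (invfm f))%E.
  by rewrite mrefl_cc intcc_refl// opprD.
split=> -[].
- by move=> h; left; apply/(oo_int_opp a b (- x)).1; rewrite opprK.
- move=> [-> [Sx [e e0]]]; rewrite E => h; right; split => //; split => //.
  by exists e.
- by move=> /(oo_int_opp a b (- x)).2; rewrite opprK; left.
- move=> [ax [Sx [e e0 h]]]; right; split; first by rewrite -[a]oppeK ax EFinN oppeK.
  by split => //; exists e => //; rewrite E.
Qed.

Lemma in_Iplus_refl x : in_Iplus (refl f) (mrefl mu) (srefl Sg) x <->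
  in_Iminus f mu Sg (- x).
Proof.
split=> -[a [b [abm xI]]].
  by exists (- b)%E, (- a)%E; split; [exact/max_dom_inc_refl|exact/Iplus_refl].
exists (- b)%E, (- a)%E; split.
  by apply/max_dom_inc_refl; rewrite !oppeK.
by apply/Iplus_refl; rewrite !oppeK.
Qed.

Lemma Fplus_refl x b : Fplus (refl f) (mrefl mu) x b = Fminus f mu (- x) (- b)%E.
Proof.
rewrite /Fplus /Fminus invfp_refl//; last exact: measurable_co_int.
rewrite mreflE (_ : [set y | co_int x b (- y)] = oc_int (- b)%E (- x))//.
apply/seteqP; split => y [h1 h2]; split.
- by rewrite leeNl -EFinN.
- by rewrite lerNr.
- by rewrite lerNr.
- by rewrite EFinN leeNl.
Qed.

Lemma Splus_spec_refl x t y :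
  Splus_spec (refl f) (mrefl mu) (srefl Sg) x t y <->
  Sminus_spec f mu Sg (- x) t (- y).
Proof.
split=> h a b abm xI /=.
- have [||h1 h2] := h (- b)%E (- a)%E.
  + by apply/max_dom_inc_refl; rewrite !oppeK.
  + by apply/Iplus_refl; rewrite !oppeK.
  rewrite !Fplus_refl !oppeK in h1 h2; rewrite !EFinN; split.
    by move=> /h1[? [? ?]]; rewrite lerN2 lteNr.
  by move=> /h2 ->; rewrite oppeK.
- have [||h1 h2] := h (- b)%E (- a)%E.
  + exact/max_dom_inc_refl.
  + exact/Iplus_refl.
  rewrite !Fplus_refl; rewrite EFinN in h1 h2; split.
    by move=> /h1[? [? ?]]; rewrite -lerN2 -lteN2.
  by move=> /h2 /oppe_inj.
Qed.

End refl_plus.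

Lemma in_Iminus_refl f mu Sg x : measurable_fun setT f ->
  in_Iminus (refl f) (mrefl mu) (srefl Sg) x <-> in_Iplus f mu Sg (- x).
Proof.
move=> mf; rewrite -{1}(opprK x) -in_Iplus_refl; last exact: measurable_refl.
by rewrite reflK mreflK sreflK.
Qed.

Lemma caratheodory_refl f x0 (x : R -> R) : caratheodory f x0 x ->
  caratheodory (refl f) (- x0) (fun t => - x t).
Proof.
move=> h t t0; have [hi hE] := h t t0.
have E : (fun s => (refl f (- x s))%:E) = (fun s => - (f (x s))%:E)%E.
  by apply/funext => s; rewrite /refl opprK EFinN.
rewrite E; split; first exact: integrableN.
rewrite EFinN hE integralN; last exact: integrable_add_def.
by rewrite oppeD// EFinN.
Qed.

Definition flowrefl (S : R -> R -> R) : R -> R -> R := fun x t => - S (- x) t.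

Lemma compatible_semigroup_refl f S : compatible_semigroup f S ->
  compatible_semigroup (refl f) (flowrefl S).
Proof.
move=> [S0 [SD Sc]]; split; first by move=> x; rewrite /flowrefl S0 opprK.
split; first by move=> x s t s0 t0; rewrite /flowrefl opprK SD.
by move=> x; rewrite -[x]opprK; apply: caratheodory_refl; rewrite opprK; exact: Sc.
Qed.

End reflection.

(** * From the construction to a compatible semigroup *)

Section constructed_is_compatible.
Context {R : realType}.
Implicit Types (f : R -> R) (mu : {measure set (RB R) -> \bar R}) (Sg : set R).
Implicit Types (x y t : R) (S : R -> R -> R).

Lemma in_Iplus_Rplus f mu Sg x : measurable_fun setT f ->
  (forall x, mu [set x] = 0%E) -> in_Iplus f mu Sg x -> Rplus_set f x.
Proof.
move=> mf mu1 [a [b [[ab _] xI]]].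
have [_ xb _ xd] := Iplus_lty mf mu1 ab xI.
have [d /andP[xd' db]] := ereal_between xb; rewrite lte_fin in xd'.
exists (d - x); first by rewrite subr_gt0.
by rewrite addrC subrK; exact: (hitm_lty (measurable_cc _ _) (xd d db)).2.
Qed.

(** The rules for [S] away from [x] are hypotheses, so that the lemma applies to the flow and to its
    reflection alike. *)
Lemma in_Iplus_flow f mu Sg S M x : measurable_fun setT f ->
  (forall y, `|f y| <= M) -> (forall y, mu [set y] = 0%E) ->
  mu (~` (f @^-1` [set 0])) = 0%E ->
  (forall y t, 0 <= t -> in_Iplus f mu Sg y -> ~ in_Iminus f mu Sg y ->
    Splus_spec f mu Sg y t (S y t)) ->
  (forall y t, 0 <= t -> ~ in_Iplus f mu Sg y -> ~ in_Iminus f mu Sg y ->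
    S y t = y /\ f y = 0) ->
  in_Iplus f mu Sg x -> (forall t, 0 <= t -> Splus_spec f mu Sg x t (S x t)) ->
  [/\ S x 0 = x, forall s t, 0 <= s -> 0 <= t -> S (S x s) t = S x (t + s) &
    caratheodory f x (S x)].
Proof.
move=> mf fM mu1 muf Sp S0 [a [b [abmax xI]]] Sx; split.
- exact: (Splus0 mf fM mu1 abmax xI Sx).
- apply: (Splus_semigroup mf fM mu1 abmax xI Sx).
    (* An interior point of a domain of increase is never in a set [Iminus], so [S] moves it to the
       right whatever [Phi] is. *)
    move=> y t yab t0; apply: Sp => //; first by exists a, b; split => //; left.
    have /andP[ay yb] := yab; have [_ _ abm] := (dom_incP mf _ _ _ _).1 abmax.1.
    have [z /andP[az zy]] := ereal_between ay; rewrite lte_fin in zy.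
    apply: (@left_lty_not_Iminus _ _ mf _ _ _ (y - z)); first by rewrite subr_gt0.
    by rewrite subKr; exact: (hitm_lty (measurable_cc _ _) (abm _ _ (ltW zy) az yb)).2.
  move=> be t bE tauoo t0.
  have [be' bE' [_ n1 n2]] := finite_end mf fM mu1 abmax xI tauoo.
  have -> : be = be' by move: bE'; rewrite bE => -[].
  by have [] := S0 be' t t0 n1 n2.
- apply: (Splus_caratheodory mf fM mu1 muf abmax xI Sx) => be bE tauoo.
  have [be' bE' [_ n1 n2]] := finite_end mf fM mu1 abmax xI tauoo.
  have -> : be = be' by move: bE'; rewrite bE => -[].
  by have [] := S0 be' 0 (lexx _) n1 n2.
Qed.

Lemma mrefl_set1 mu x : mrefl mu [set x] = mu [set - x].
Proof.
rewrite mreflE; congr (mu _); apply/seteqP; split => y /= h.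
  by rewrite -h opprK.
by rewrite h opprK.
Qed.

Lemma mrefl_support f mu : mrefl mu (~` (refl f @^-1` [set 0])) =
  mu (~` (f @^-1` [set 0])).
Proof.
rewrite mreflE; congr (mu _); apply/seteqP; split => y /= h h'; apply: h.
  by rewrite /refl opprK h' oppr0.
by move: h'; rewrite /refl opprK => /eqP; rewrite oppr_eq0 => /eqP.
Qed.

Lemma constructed_compatible f mu Sg (Phi : R -> R) S : A1 f -> A2 f ->
  (forall x, mu [set x] = 0%E) -> mu (~` (f @^-1` [set 0])) = 0%E ->
  Sg `<=` f @^-1` [set 0] ->
  (forall x, Omega_star f x -> Phi x = 1 \/ Phi x = -1) ->
  constructed_semigroup f mu Sg Phi S -> compatible_semigroup f S.
Proof.
move=> [[M fM] rf] fA2 mu1 muf Sgf PhiP SP.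
have mf := regulated_measurable rf.
have mfr := measurable_refl mf.
have fMr := refl_bound fM.
have mur1 x : mrefl mu [set x] = 0%E by rewrite mrefl_set1.
have murf : mrefl mu (~` (refl f @^-1` [set 0])) = 0%E by rewrite mrefl_support.
have Sgrf : srefl Sg `<=` refl f @^-1` [set 0].
  by move=> y /Sgf/= fy; rewrite /refl fy oppr0.
(* If [f x] is nonzero, (A2) makes both one-sided limits nonzero and excludes left positive, right
   negative. Either the right limit is positive and [x] can be left to the right, or both are
   negative and it can be left to the left. *)
have f0 x : ~ in_Iplus f mu Sg x -> ~ in_Iminus f mu Sg x -> f x = 0.
  move=> nIp nIm; apply: contrapT => /eqP fx.
  have fA2' := contra_not (fA2 x) ltac:(exact/eqP).
  have fr0 : fright f x != 0.
    by apply/eqP => h; apply: fA2'; left; rewrite h mulr0.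
  have fl0 : fleft f x != 0.
    by apply/eqP => h; apply: fA2'; left; rewrite h mul0r.
  have [frn|frp|frE] := ltgtP (fright f x) 0; last by rewrite frE eqxx in fr0.
    have fln : fleft f x < 0.
      rewrite lt_neqAle fl0/= leNgt; apply/negP => flp.
      by apply: fA2'; right.
    apply: nIm; rewrite -[x]opprK; apply/(in_Iplus_refl mu Sg mf).
    have e0 : 0 < - fleft f x / 2 by lra.
    have [d d0 dP] := at_left_near e0 (rf x).1.
    apply: (in_Iplus_right_pos mfr mur1 murf (e := d) Sgrf _ d0 e0).
      by rewrite /refl opprK oppr_eq0.
    move=> z /andP[xz zd]; have := dP (- z) ltac:(by apply/andP; split; lra).
    by rewrite -/(fleft f x) ltr_distl /refl => /andP[]; lra.
  apply: nIp; have e0 : 0 < fright f x / 2 by lra.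
  have [d d0 dP] := at_right_near e0 (rf x).2.
  apply: (in_Iplus_right_pos mf mu1 muf (e := d) Sgf fx d0 e0).
  move=> z xz; have := dP z xz.
  by rewrite -/(fright f x) ltr_distl => /andP[]; lra.
have Om x : in_Iplus f mu Sg x -> in_Iminus f mu Sg x -> Omega_star f x.
  move=> xIp xIm; split; last exact: (in_Iplus_Rplus mf mu1 xIp).
  rewrite -[x]opprK in xIm; move/(in_Iplus_refl mu Sg mf) : xIm.
  move=> /(in_Iplus_Rplus mfr mur1)[e e0]; rewrite intcc_refl// opprD !opprK => h.
  by exists e => //; rewrite -lteN2.
pose plus x := in_Iplus f mu Sg x /\
  forall t, 0 <= t -> Splus_spec f mu Sg x t (S x t).
pose minus x := in_Iminus f mu Sg x /\
  forall t, 0 <= t -> Sminus_spec f mu Sg x t (S x t).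
pose rest x := forall t, 0 <= t -> S x t = x /\ f x = 0.
have tri x : [\/ plus x, minus x | rest x].
  have [Ip|nIp] := pselect (in_Iplus f mu Sg x);
  have [Im|nIm] := pselect (in_Iminus f mu Sg x).
  - have [Phi1|Phi1] := PhiP x (Om x Ip Im).
      apply: Or31; split => // t t0; have [_ [_ [_ h]]] := SP x t t0.
      by have [/(_ Phi1)] := h Ip Im.
    apply: Or32; split => // t t0; have [_ [_ [_ h]]] := SP x t t0.
    by have [_ /(_ Phi1)] := h Ip Im.
  - by apply: Or31; split => // t t0; have [_ [h _]] := SP x t t0; exact: h.
  - by apply: Or32; split => // t t0; have [_ [_ [h _]]] := SP x t t0; exact: h.
  - apply: Or33 => t t0; have [h _] := SP x t t0.
    by split; [exact: h|exact: f0].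
have all3 x : [/\ S x 0 = x,
    forall s t, 0 <= s -> 0 <= t -> S (S x s) t = S x (t + s) &
    caratheodory f x (S x)].
  have [[xI xS]|[xI xS]|xS] := tri x.
  - apply: (in_Iplus_flow mf fM mu1 muf) xI xS.
      by move=> y t t0 Ip nIm; have [_ [h _]] := SP y t t0; exact: h.
    by move=> y t t0 nIp nIm; have [h _] := SP y t t0; split; [exact: h|exact: f0].
  - have [||||h0 hD hc] := @in_Iplus_flow _ (mrefl mu) (srefl Sg) (flowrefl S) M (- x)
      mfr fMr mur1 murf.
    + move=> y t t0 /(in_Iplus_refl mu Sg mf) Im /(in_Iminus_refl _ _ _ mf) nIp.
      apply/Splus_spec_refl => //; rewrite /flowrefl opprK.
      by have [_ [_ [h _]]] := SP (- y) t t0; exact: h.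
    + move=> y t t0 /(in_Iplus_refl mu Sg mf) nIm /(in_Iminus_refl _ _ _ mf) nIp.
      have [h _] := SP (- y) t t0.
      by rewrite /flowrefl /refl h// f0// opprK oppr0.
    + by apply/in_Iplus_refl; rewrite ?opprK.
    + move=> t t0; apply/Splus_spec_refl => //.
      by rewrite /flowrefl !opprK; exact: xS.
    rewrite /flowrefl !opprK in h0 hD hc; split.
    + exact: oppr_inj.
    + by move=> s t s0 t0; apply: oppr_inj; rewrite -hD// opprK.
    + have := caratheodory_refl hc; rewrite reflK opprK.
      by under [X in caratheodory _ _ X]eq_fun do rewrite opprK.
  - have xS' t : 0 <= t -> S x t = x by move=> t0; have [] := xS t t0.
    have fx : f x = 0 by have [] := xS 0 (lexx 0).
    split; first exact: xS'.
      by move=> s t s0 t0; rewrite !xS'//; lra.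
    move=> t t0; have E : {in cc 0 t, (fun=> 0%E) =1 (fun s => (f (S x s))%:E)}.
      by move=> s /set_mem/ccP/andP[s0 _]; rewrite xS'// fx.
    split.
      apply: (@eq_integrable _ _ _ _ _ (measurable_cc 0 t) (fun=> 0%E)) => //.
      exact: integrable0.
    by rewrite integral0_eq ?adde0 ?xS'// => s /mem_set/E <-.
split; first by move=> x; have [] := all3 x.
split; first by move=> x s t; have [_ h _] := all3 x; exact: h.
by move=> x; have [] := all3 x.
Qed.

End constructed_is_compatible.

(** * Crossing times of a level by a continuous function *)

Section crossing_times.
Context {R : realType}.
Implicit Types (g : R -> R) (a b r t w : R).

(** The supremum of the times with [g <= w]. The exact value [w] at the crossing is what later lets
    the semigroup law identify two positions. *)
Lemma last_crossing g a b w : continuous g -> a <= b -> g a <= w -> w < g b ->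
  exists r, [/\ a <= r, r < b, g r = w & forall t, r < t <= b -> w < g t].
Proof.
move=> cg ab gaw wgb; pose E := [set t | a <= t <= b /\ g t <= w].
have Ea : E a by split => //; rewrite lexx.
have Eb : ubound E b by move=> t [/andP[]].
have supE : has_sup E by split; [exists a|exists b].
have ar : a <= sup E by apply: ub_le_sup => //; exists b.
have rb : sup E <= b by apply: ge_sup => //; exists a.
have gt t : sup E < t <= b -> w < g t.
  move=> /andP[rt tb]; rewrite ltNge; apply/negP => gtw.
  have Et : E t by split => //; rewrite tb (le_trans ar)// ltW.
  by have := ub_le_sup supE.2 Et; rewrite leNgt rt.
have grw : g (sup E) <= w.
  rewrite leNgt; apply/negP => wgr.
  have e0 : 0 < g (sup E) - w by rewrite subr_gt0.
  have /cvgrPdist_lt /(_ _ e0) [d /= d0 dP] := cg (sup E).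
  have [t Et tr] := sup_adherent d0 supE.
  have tr' := ub_le_sup supE.2 Et.
  have := dP t; rewrite /ball_/= ger0_norm ?subr_ge0//.
  by move=> /(_ ltac:(lra)); rewrite ltr_distl => /andP[]; case: Et => _; lra.
have rb' : sup E < b.
  by rewrite lt_neqAle rb andbT; apply/eqP => rE; move: grw; rewrite rE leNgt wgb.
exists (sup E); split => //.
apply/eqP; rewrite eq_le grw/= leNgt; apply/negP => grw'.
have [|c /itvP crb gc] := @IVT R g (sup E) b w rb (continuous_subspaceT cg).
  by rewrite ge_min le_max grw/= (ltW wgb) orbT.
have cr : sup E < c.
  rewrite lt_neqAle crb andbT; apply/eqP => rc.
  by move: grw'; rewrite rc gc ltxx.
by have := gt c; rewrite cr crb gc ltxx => /(_ isT).
Qed.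

Lemma first_crossing g a b w : continuous g -> a <= b -> w < g a -> g b <= w ->
  exists r, [/\ a < r, r <= b, g r = w & forall t, a <= t < r -> w < g t].
Proof.
move=> cg ab wga gbw.
have cgN : continuous (g \o -%R).
  by move=> t; apply: continuous_comp; [exact: oppr_continuous|exact: cg].
have [|||r [r1 r2 r3 r4]] := last_crossing (a := - b) (b := - a) (w := w) cgN.
- by rewrite lerN2.
- by rewrite /= opprK.
- by rewrite /= opprK.
exists (- r); split=> //; [by rewrite ltrNr|by rewrite lerNl|].
move=> t /andP[at' tr]; have := r4 (- t); rewrite /= opprK; apply.
by rewrite ltrNr tr lerN2.
Qed.

End crossing_times.

(** * Orbits of a semigroup on the line *)

Section orbits.
Context {R : realType}.
Variable M : R.
Implicit Types (f : R -> R) (S : R -> R -> R) (c d r s t u x y z : R).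
Local Notation leb := (@lebesgue_measure R).

(* The vector field matters only through its bound, which makes orbits
   continuous. *)
Definition bounded_flow S :=
  exists2 f, (forall x, `|f x| <= M) & compatible_semigroup f S.

Definition pos S x := exists2 t, 0 <= t & x < S x t.
Definition neg S x := exists2 t, 0 <= t & S x t < x.
Definition fixd S x := forall t, 0 <= t -> S x t = x.

Lemma bounded_flow_refl S : bounded_flow S -> bounded_flow (flowrefl S).
Proof.
move=> [f fM fS]; exists (refl f); first exact: refl_bound.
exact: compatible_semigroup_refl.
Qed.

Lemma flow0 S x : bounded_flow S -> S x 0 = x.
Proof. by move=> [f _ []]. Qed.

Lemma flowD S x s t : bounded_flow S -> 0 <= s -> 0 <= t ->
  S (S x s) t = S x (t + s).
Proof. by move=> [f _ [_ []]]; auto. Qed.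

Lemma flowB S x s t : bounded_flow S -> 0 <= s -> s <= t ->
  S x t = S (S x s) (t - s).
Proof. by move=> Sf s0 st; rewrite flowD// ?subrK// subr_ge0. Qed.

Lemma flow_dist S y r : bounded_flow S -> 0 <= r -> `|S y r - y| <= M * r.
Proof.
move=> [f fM [_ [_ Sc]]] r0; have [fi fE] := Sc y r r0.
have IE : (\int[leb]_(s in cc 0 r) (f (S y s))%:E = (S y r - y)%:E)%E.
  by rewrite EFinB fE addeAC subee// add0e.
have mfi := measurable_int _ fi.
rewrite -lee_fin -[X in (X <= _)%E]/(`|(S y r - y)%:E|)%E -IE.
apply: le_trans (le_abse_integral _ (measurable_cc 0 r) mfi) _.
apply: (@le_trans _ _ (\int[leb]_(s in cc 0 r) M%:E)%E).
  apply: ge0_le_integral => //; first exact: measurableT_comp.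
  by move=> s _; rewrite lee_fin.
by rewrite (integral_cst _ (measurable_cc 0 r))/= lebesgue_cc// subr0.
Qed.

Lemma flow_lip S x s t : bounded_flow S -> 0 <= s -> 0 <= t ->
  `|S x t - S x s| <= M * `|t - s|.
Proof.
move=> Sf; wlog st : s t / s <= t => [h|] s0 t0.
  have [/h|/ltW/h] := leP s t; first exact.
  by rewrite distrC (distrC t); apply.
rewrite (flowB _ Sf s0 st) [`|t - s|]ger0_norm ?subr_ge0//.
by apply: flow_dist => //; rewrite subr_ge0.
Qed.

(** [S] is arbitrary at negative times; freezing the orbit there makes it continuous on the whole
    line. *)
Definition orbit S x t := S x (Num.max 0 t).

Lemma orbitE S x t : 0 <= t -> orbit S x t = S x t.
Proof. by move=> t0; rewrite /orbit (max_idPr t0). Qed.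

Lemma continuous_orbit S x : bounded_flow S -> continuous (orbit S x).
Proof.
move=> Sf t; apply/cvgrPdist_lt => e e0.
have M0 : 0 <= M by have [f fM _] := Sf; exact: le_trans (normr_ge0 _) (fM 0).
have d0 : 0 < e / (M + 1) by rewrite divr_gt0//; lra.
exists (e / (M + 1)) => //= s; rewrite /ball_/= => st.
apply: le_lt_trans (flow_lip _ Sf _ _) _; rewrite ?le_max ?lexx//.
apply: (@le_lt_trans _ _ ((M + 1) * `|t - s|)); last first.
  by rewrite mulrC -ltr_pdivlMr//; lra.
apply: ler_pM => //; first lra.
rewrite /Num.max; case: ifPn => t1; case: ifPn => s1 //;
  rewrite -?leNgt in t1 s1.
- by rewrite subr0 (gtr0_norm t1) ler_normr; apply/orP; left; lra.
- by rewrite sub0r normrN (gtr0_norm s1) ler_normr; apply/orP; right; lra.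
- by rewrite subrr normr0.
Qed.

Lemma no_turn S x r s u : bounded_flow S -> 0 <= r -> r <= s -> s <= u ->
  S x r < S x s -> S x u < S x s -> False.
Proof.
move=> Sf r0 rs su xrs xus; have s0 := le_trans r0 rs.
(* A level strictly between both ends and the peak; it is crossed upwards at [r1] and downwards at
   [r2]. *)
pose v := (Num.max (S x r) (S x u) + S x s) / 2.
have h1 : S x r <= Num.max (S x r) (S x u) by rewrite le_max lexx.
have h2 : S x u <= Num.max (S x r) (S x u) by rewrite le_max lexx orbT.
have h3 : Num.max (S x r) (S x u) < S x s by rewrite gt_max xrs.
have vs : v < S x s by rewrite /v; lra.
have rv : S x r < v by rewrite /v; lra.
have uv : S x u < v by rewrite /v; lra.
have cX := @continuous_orbit S x Sf.
have [||r1 [rr1 r1s Xr1 r1P]] := last_crossing (w := v) cX rs.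
- by rewrite orbitE// ltW.
- by rewrite orbitE.
have [||r2 [sr2 r2u Xr2 r2P]] := first_crossing (w := v) cX su.
- by rewrite orbitE.
- by rewrite orbitE ?ltW//; lra.
have r10 : 0 <= r1 by lra.
rewrite orbitE// in Xr1; rewrite orbitE in Xr2; last lra.
have p0 : 0 < r2 - r1 by lra.
have Xv t : r1 <= t <= r2 -> v <= S x t.
  move=> /andP[r1t tr2]; rewrite -orbitE; last lra.
  have [ts|st] := leP t s.
    move: r1t; rewrite le_eqVlt => /predU1P[<-|r1t]; first by rewrite orbitE// Xr1.
    by apply/ltW/r1P; rewrite r1t.
  move: tr2; rewrite le_eqVlt => /predU1P[->|tr2]; first by rewrite orbitE ?Xr2//; lra.
  by apply/ltW/r2P; rewrite tr2 ltW.
(* The orbit is at [v] at both times [r1] and [r2], so the semigroup law repeats the arc between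
   them with period [r2 - r1]. Enough periods cover the time [u], where the orbit should be below
   [v]. *)
have Xper n t : r1 <= t <= r1 + (r2 - r1) * n.+1%:R -> v <= S x t.
  elim: n t => [|n IH] t /andP[r1t tn].
    by apply: Xv; rewrite r1t/=; move: tn; rewrite mulr1; lra.
  have [tr2|r2t] := leP t r2; first by apply: Xv; rewrite r1t.
  have -> : S x t = S x (t - (r2 - r1)).
    rewrite (flowB _ Sf (s := r2)) ?ltW//; last lra.
    rewrite Xr2 -Xr1 flowD//; last lra.
    by congr (S x _); lra.
  apply: IH; apply/andP; split; first lra.
  by move: tn; rewrite -[n.+2%:R]natr1 mulrDr mulr1; lra.
suff : v <= S x u by rewrite leNgt uv.
apply: (Xper (Num.truncn ((u - r1) / (r2 - r1)))); apply/andP; split; first lra.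
have := truncnS_gt ((u - r1) / (r2 - r1)).
by rewrite ltr_pdivrMr// mulrC; lra.
Qed.

Lemma no_turn_min S x r s u : bounded_flow S -> 0 <= r -> r <= s -> s <= u ->
  S x s < S x r -> S x s < S x u -> False.
Proof.
move=> Sf r0 rs su h1 h2.
apply: (@no_turn (flowrefl S) (- x) r s u) => //; first exact: bounded_flow_refl.
- by rewrite /flowrefl opprK ltrN2.
- by rewrite /flowrefl opprK ltrN2.
Qed.

(** The orbit never goes below [x]: whichever of the values above and below [x] came first would be
    a peak or a trough. A later descent is then a turn as seen from time 0. *)
Lemma pos_nondecr S x s t : bounded_flow S -> pos S x -> 0 <= s -> s <= t ->
  S x s <= S x t.
Proof.
move=> Sf [t1 t10 xt1] s0 st.
have ge t' : 0 <= t' -> x <= S x t'.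
  move=> t'0; rewrite leNgt; apply/negP => h; have S0 := flow0 x Sf.
  have [t1t'|t't1] := leP t1 t'.
    by apply: (@no_turn S x 0 t1 t'); rewrite ?S0//; exact: lt_trans h xt1.
  apply: (@no_turn_min S x 0 t' t1); rewrite ?S0//; first exact: ltW.
  exact: lt_trans h xt1.
rewrite leNgt; apply/negP => h.
have xt := ge t (le_trans s0 st).
by apply: (@no_turn S x 0 s t) => //; rewrite flow0//; exact: le_lt_trans h.
Qed.

Lemma neg_nonincr S x s t : bounded_flow S -> neg S x -> 0 <= s -> s <= t ->
  S x t <= S x s.
Proof.
move=> Sf [u u0 xu] s0 st; rewrite -lerN2.
have := @pos_nondecr (flowrefl S) (- x) s t (bounded_flow_refl Sf).
by rewrite /flowrefl opprK; apply => //; exists u => //; rewrite opprK ltrN2.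
Qed.

Lemma pos_neg_fixd S x : [\/ pos S x, neg S x | fixd S x].
Proof.
have [|np] := pselect (pos S x); first exact: Or31.
have [|nn] := pselect (neg S x); first exact: Or32.
apply: Or33 => t t0; apply/eqP; rewrite eq_le !leNgt.
by apply/andP; split; apply/negP => h; [apply: np|apply: nn]; exists t.
Qed.

Lemma pos_neg S x : bounded_flow S -> pos S x -> ~ neg S x.
Proof.
move=> Sf px [t t0]; rewrite ltNge -{1}(flow0 x Sf).
by rewrite (pos_nondecr Sf px).
Qed.

Lemma pos_fixd S x : pos S x -> ~ fixd S x.
Proof. by move=> [t t0 xt] /(_ t t0) xE; rewrite xE ltxx in xt. Qed.

Lemma neg_fixd S x : neg S x -> ~ fixd S x.
Proof. by move=> [t t0 xt] /(_ t t0) xE; rewrite xE ltxx in xt. Qed.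

(** An orbit is monotone, and a monotone periodic function is constant. *)
Lemma return_fixd S y p : bounded_flow S -> 0 < p -> S y p = y -> fixd S y.
Proof.
move=> Sf p0 Syp.
have per n : S y (p * n%:R) = y.
  elim: n => [|n IH]; first by rewrite mulr0 flow0.
  rewrite -natr1 mulrDr mulr1 addrC.
  have pn0 : 0 <= p * n%:R by rewrite mulr_ge0// ltW.
  by rewrite -(flowD _ Sf pn0 (ltW p0)) IH.
have arch t : t <= p * (Num.truncn (t / p)).+1%:R.
  by have := truncnS_gt (t / p); rewrite ltr_pdivrMr// mulrC => /ltW.
have [py|ny|//] := pos_neg_fixd S y.
  have [t t0] := py; rewrite ltNge -{2}(per (Num.truncn (t / p)).+1) => /negP[].
  exact: pos_nondecr.
have [t t0] := ny; rewrite ltNge -{1}(per (Num.truncn (t / p)).+1) => /negP[].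
exact: neg_nonincr.
Qed.

(** The strict inequality asks the orbit to go beyond [y], which leaves out a point where it comes
    to rest. *)
Definition reach S c : set R := [set y | c <= y /\ exists2 t, 0 <= t & y < S c t].

Lemma reach_pos S c y : reach S c y -> pos S c.
Proof. by move=> [cy [t t0 yt]]; exists t => //; exact: le_lt_trans yt. Qed.

Lemma reach_time S c y : bounded_flow S -> reach S c y ->
  exists s, [/\ 0 <= s, S c s = y & pos S y].
Proof.
move=> Sf yc; have [cy [t t0 yt]] := yc.
have [|s /itvP st sy] := @IVT R (orbit S c) 0 t y t0
    (continuous_subspaceT (@continuous_orbit S c Sf)).
  by rewrite !orbitE// flow0// ge_min le_max cy (ltW yt) orbT.
have s0 : 0 <= s by rewrite st.
rewrite orbitE// in sy; exists s; split => //.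
exists (t - s); first by rewrite subr_ge0 st.
by rewrite -{2}sy -(flowB _ Sf s0) ?st.
Qed.

(** Equal positions at two times would make the point fixed, but points in [reach] still move
    right. *)
Lemma reach_lt S c s t : bounded_flow S -> 0 <= s -> reach S c (S c s) -> s < t ->
  S c s < S c t.
Proof.
move=> Sf s0 sc st; have pc := reach_pos sc.
rewrite lt_neqAle (pos_nondecr Sf pc s0 (ltW st)) andbT; apply/eqP => E.
have := @return_fixd S (S c s) (t - s) Sf; rewrite subr_gt0 => /(_ st).
rewrite -(flowB _ Sf s0 (ltW st)) => /(_ (esym E)); apply: pos_fixd.
have [s' [s'0 _]] := reach_time Sf sc; exact.
Qed.

Lemma reach_le S c s t : bounded_flow S -> 0 <= s -> 0 <= t ->
  reach S c (S c s) -> (S c t <= S c s) = (t <= s).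
Proof.
move=> Sf s0 t0 sc; have [ts|st] := leP t s.
  by rewrite (pos_nondecr Sf (reach_pos sc) t0 ts).
by apply/negbTE; rewrite -ltNge; exact: reach_lt.
Qed.

Lemma reach_down S c y z : reach S c y -> c <= z -> z <= y -> reach S c z.
Proof.
move=> [cy [t t0 yt]] cz zy; split => //; exists t => //; exact: le_lt_trans yt.
Qed.

Lemma reach_trans S c y z : bounded_flow S -> reach S c y -> reach S y z ->
  reach S c z.
Proof.
move=> Sf cy [yz [t t0 zt]]; have [s [s0 sy _]] := reach_time Sf cy.
split; first exact: le_trans cy.1 yz.
by exists (t + s); [lra|rewrite -flowD// sy].
Qed.

Lemma reach_sub S c y z : bounded_flow S -> reach S c y -> c <= z -> z <= y ->
  reach S z y.
Proof.
move=> Sf cy cz zy; have [s [s0 sz _]] := reach_time Sf (reach_down cy cz zy).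
have [_ [t t0 yt]] := cy; split => //.
have st : s <= t.
  rewrite leNgt; apply/negP => ts.
  have := pos_nondecr Sf (reach_pos cy) t0 (ltW ts).
  by rewrite sz leNgt (le_lt_trans zy yt).
by exists (t - s); [rewrite subr_ge0|rewrite -sz -(flowB _ Sf s0 st)].
Qed.

End orbits.

(** * Null points and translation invariance *)

Section null_points.
Context {R : realType}.
Implicit Types (m : {measure set (RB R) -> \bar R}) (A : set (RB R)) (x s : R).
Local Notation leb := (@lebesgue_measure R).

Lemma measure_setD1 m A x : measurable A -> m [set x] = 0%E -> m (A `\` [set x]) = m A.
Proof.
move=> mA mx; have mD : measurable (A `\` [set x]) by exact: measurableD.
apply/eqP; rewrite eq_le; apply/andP; split.
  by rewrite le_measure ?inE//; exact: subDsetl.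
have -> : m (A `\` [set x]) = (m (A `\` [set x]) + m [set x])%E by rewrite mx adde0.
apply: le_trans (measureU2 m mD (measurable_set1 x)).
rewrite le_measure ?inE//; first exact: measurableU.
by move=> y Ay; have [->|yx] := pselect (y = x); [right|left].
Qed.

Lemma measurable_shift s : measurable_fun setT ((fun t => t + s) : RB R -> RB R).
Proof. by apply: measurable_funD. Qed.

Lemma lebesgue_measure_shift s A : measurable A ->
  leb [set t | A (t + s)] = leb A.
Proof.
move=> mA; apply/esym.
apply: (@lebesgue_measure_unique _ (mpush (measurable_shift s) leb)) => //.
move=> _ [[a b]] _ <-; rewrite /= /mpush/=.
rewrite (_ : _ @^-1` _ = `]a - s, b - s]%classic); last first.
  by apply/seteqP; split => t /=; rewrite !in_itv/= ltrBlDr lerBrDr.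
by rewrite !lebesgue_measure_itv/= !lte_fin ltrD2r -!EFinB opprB addrA subrK.
Qed.

End null_points.

(** * Occupation measures of right-moving orbits *)

Section occupation_time.
Context {R : realType}.
Variables (M : R) (S : R -> R -> R).
Hypothesis Sf : bounded_flow M S.
Implicit Types (c d q s t x y : R) (A : set (RB R)).
Local Notation leb := (@lebesgue_measure R).

Lemma measurable_orbit c : measurable_fun setT (orbit S c : RB R -> RB R).
Proof. by apply: continuous_measurable_fun; exact: (continuous_orbit Sf). Qed.

Lemma measurable_reach c : measurable (reach S c : set (RB R)).
Proof.
apply: is_interval_measurable => x y [cx _] [_ [t t0 yt]] z /andP[xz zy].
by split; [exact: le_trans xz|exists t => //; exact: le_lt_trans yt].
Qed.

Lemma measurable_future : measurable (`[0, +oo[%classic : set (RB R)).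
Proof. exact: measurable_itv. Qed.

(** The time spent in a set by the orbit of [c]. The restriction to [reach S c] discards the
    infinite time spent at a resting point, which would be an atom. *)
Definition occ c : {measure set (RB R) -> \bar R} :=
  mrestr (mpush (measurable_orbit c) (mrestr leb measurable_future))
    (measurable_reach c).

Lemma occE c A :
  occ c A = leb [set t | 0 <= t /\ (A `&` reach S c) (S c t)].
Proof.
rewrite /occ/= /mrestr/= /mpush/= /mrestr; congr (leb _).
apply/seteqP; split => t /=.
  by rewrite in_itv/= andbT => -[h t0]; rewrite -(orbitE S c t0).
by move=> [t0 h]; rewrite in_itv/= andbT t0 orbitE.
Qed.

Lemma occ_set1 c x : occ c [set x] = 0%E.
Proof.
rewrite occE; set B := [set t | _].
have [[s [s0 [sx sc]]]|B0] := pselect (B !=set0); last first.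
  rewrite (_ : B = set0) ?measure0//; apply/seteqP; split => // t Bt.
  by apply: B0; exists t.
rewrite (_ : B = [set s]) ?lebesgue_measure_set1//.
apply/seteqP; split => [t [t0 [tx tc]]|_ ->]; last by split.
have E : S c t = S c s by rewrite tx sx.
have := reach_le Sf s0 t0 sc; have := reach_le Sf t0 s0 tc.
by rewrite E lexx => /esym st /esym ts; apply/eqP; rewrite eq_le ts st.
Qed.

(** The orbit of [q] passes through [c] at some time [s] and is below [c] before. The two sets of
    times thus differ by a shift by [s]. *)
Let occ_eq_le c q A : measurable A -> A `<=` reach S c -> A `<=` reach S q ->
  q <= c -> occ c A = occ q A.
Proof.
move=> mA Ac Aq qc.
have [->|/set0P[z Az]] := eqVneq A set0; first by rewrite !measure0.
have qc' : reach S q c := reach_down (Aq z Az) qc (Ac z Az).1.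
have [s [s0 sc _]] := reach_time Sf qc'.
rewrite !occE !setIidl//.
have mB : measurable ([set t | 0 <= t /\ A (S q t)] : set (RB R)).
  rewrite (_ : [set t | _] = (orbit S q @^-1` A) `&` `[0, +oo[%classic).
    apply: measurableI => //; rewrite -[X in measurable X]setTI.
    exact: measurable_orbit.
  apply/seteqP; split => t /=; rewrite in_itv/= andbT.
    by move=> [t0 At]; rewrite orbitE.
  by move=> [At t0]; rewrite orbitE// in At.
rewrite -(lebesgue_measure_shift s mB); congr (leb _).
apply/seteqP; split => t /= [t0 At].
  by split; [lra|rewrite -(flowD _ Sf)// sc].
have ts : 0 <= t.
  rewrite leNgt; apply/negP => t1.
  have := reach_lt Sf t0 (Aq _ At) (t := s) ltac:(lra).
  by rewrite sc ltNge (Ac _ At).1.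
by split => //; rewrite -sc (flowD _ Sf).
Qed.

Lemma occ_eq c q A : measurable A -> A `<=` reach S c -> A `<=` reach S q ->
  occ c A = occ q A.
Proof.
move=> mA Ac Aq; have [qc|/ltW cq] := leP q c; first exact: occ_eq_le.
by apply/esym; exact: occ_eq_le.
Qed.

Definition nth_rat (n : nat) : R :=
  if choice.unpickle n is Some r then ratr (r : rat) else 0.

Definition reach_seq n : set (RB R) := seqDU (fun n => reach S (nth_rat n)) n.

Lemma measurable_reach_seq n : measurable (reach_seq n).
Proof.
apply: measurableD; first exact: measurable_reach.
by apply: bigsetU_measurable => i _; exact: measurable_reach.
Qed.

(* The measures [occ c] agree on overlaps, so they can be glued along the
   countably many orbits of rational points. *)
Definition occupation : {measure set (RB R) -> \bar R} :=
  mseries (fun n => mrestr (occ (nth_rat n)) (measurable_reach_seq n)) 0.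

Lemma occupationE A :
  occupation A = (\sum_(n <oo) occ (nth_rat n) (A `&` reach_seq n))%E.
Proof. by []. Qed.

Lemma occupation_set1 x : occupation [set x] = 0%E.
Proof.
rewrite occupationE eseries0// => n _ _; apply/eqP.
rewrite eq_le measure_ge0 andbT -(occ_set1 (nth_rat n) x) le_measure ?inE//.
by apply: measurableI => //; exact: measurable_reach_seq.
Qed.

Lemma occupation_nonpos A : (forall x, A x -> ~ pos S x) -> occupation A = 0%E.
Proof.
move=> nA; rewrite occupationE eseries0// => n _ _; rewrite occE.
rewrite (_ : [set t | _] = set0) ?measure0//.
apply/seteqP; split => // t [t0 [[At _] /(reach_time Sf)[s [_ _ pt]]]].
exact: nA At pt.
Qed.

(** Each [x > c] in the reach of [c] is also in the reach of a rational between [c] and [x]. The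
    point [c] itself may be in the reach of no rational; it is removed, being null for both
    measures. *)
Lemma occupation_reach c A : measurable A -> A `<=` reach S c ->
  occupation A = occ c A.
Proof.
move=> mA Ac; pose A' := A `\` [set c].
have mA' : measurable A' by exact: measurableD.
rewrite -(measure_setD1 mA (occupation_set1 c)) -(measure_setD1 mA (occ_set1 c c)).
rewrite -/A' occupationE.
have A'c : A' `<=` reach S c by move=> x [/Ac].
have UE : A' = \bigcup_n (A' `&` reach_seq n).
  apply/seteqP; split => [x A'x|x [n _ []]//].
  rewrite -setI_bigcupr; split => //.
  rewrite /reach_seq -seqDU_bigcup_eq.
  have [Ax /eqP xc] := A'x; have cx : c < x.
    by rewrite lt_neqAle eq_sym xc (Ac x Ax).1.
  have [r /itvP rcx] := rat_in_itvoo cx.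
  exists (choice.pickle r) => //; rewrite /nth_rat choice.pickleK.
  by apply: (reach_sub Sf (Ac x Ax)); rewrite rcx.
have mA'n n : measurable (A' `&` reach_seq n).
  by apply: measurableI => //; exact: measurable_reach_seq.
rewrite [in RHS]UE [RHS]measure_semi_bigcup//; last 2 first.
- apply/trivIsetP => i j _ _ ij.
  have /trivIsetP/(_ i j Logic.I Logic.I ij) h :=
    trivIset_seqDU (fun n => reach S (nth_rat n)).
  have hij : reach_seq i `&` reach_seq j = set0 by exact: h.
  by rewrite setIACA hij setI0.
- by rewrite -UE.
apply: eq_eseriesr => n _.
apply: occ_eq => //.
- by move=> x [_ []].
- by move=> x [/A'c].
Qed.

End occupation_time.

(** * The travel time as occupation of zeros plus the integral of [1/f^+] *)

Section travel_time.
Context {R : realType}.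
Variables (f : R -> R) (M : R) (S : R -> R -> R).
Hypothesis mf : measurable_fun setT f.
Hypothesis fM : forall x, `|f x| <= M.
Hypothesis fS : compatible_semigroup f S.
Implicit Types (A : set (RB R)).
Local Notation leb := (@lebesgue_measure R).

Lemma compatible_bounded_flow : bounded_flow M S. Proof. by exists f. Qed.
Let Sf := compatible_bounded_flow.

Let mfN : measurable_fun setT (-%R \o f). Proof. exact: measurableT_comp. Qed.

Let mle (g : R -> R) : measurable_fun setT g ->
  measurable ([set x | g x <= 0] : set (RB R)).
Proof.
by move=> mg; rewrite -[X in measurable X]setTI; exact: measurable_fun_le.
Qed.

Let mpos : measurable ([set x | 0 < f x] : set (RB R)).
Proof.
rewrite (_ : [set x | _] = ~` [set x | f x <= 0]); first by apply: measurableC; exact: mle.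
by apply/seteqP; split => x /= h; [apply/negP|move/negP: h]; rewrite -ltNge.
Qed.

Let mneg : measurable ([set x | f x < 0] : set (RB R)).
Proof.
rewrite (_ : [set x | _] = ~` [set x | (-%R \o f) x <= 0]).
  by apply: measurableC; exact: mle.
by apply/seteqP; split => x /=; rewrite oppr_le0 => h; [apply/negP|move/negP: h];
  rewrite -ltNge.
Qed.

Variables (c T : R).
Hypotheses (T0 : 0 <= T) (cT : reach S c (S c T)).
Local Notation d := (S c T).

(** The image of the bounded time interval [[0, T]], a finite measure that agrees with [occ] on
    [[c, d]]. *)
Let rho : {measure set (RB R) -> \bar R} :=
  mpush (measurable_orbit Sf c) (mrestr leb (measurable_cc 0 T)).

Let cd : c <= d. Proof. exact: cT.1. Qed.

Let cc_reach y : cc c d y -> reach S c y.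
Proof. by move=> /ccP/andP[cy yd]; exact: reach_down cT cy yd. Qed.

Let ge0_integral_rho s (h : R -> \bar R) : 0 <= s <= T ->
  measurable_fun setT (h : RB R -> \bar R) -> (forall y, 0 <= h y)%E ->
  (\int[rho]_(y in cc c (S c s)) h y = \int[leb]_(t in cc 0 s) h (S c t))%E.
Proof.
move=> /andP[s0 sT] mh h0.
rewrite ge0_integral_mpush//; last exact: measurable_funTS.
have mho : measurable_fun setT (h \o orbit S c).
  by apply: measurableT_comp => //; exact: (measurable_orbit Sf).
rewrite ge0_integral_mrestr//; last 2 first.
- by rewrite -[X in measurable X]setTI; exact: (measurable_orbit Sf).
- exact: measurable_funTS.
have -> : orbit S c @^-1` cc c (S c s) `&` cc 0 T = cc 0 s.
  have sc : reach S c (S c s).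
    apply: cc_reach; apply/ccP; rewrite -{1}(flow0 c Sf).
    by rewrite !(pos_nondecr Sf (reach_pos cT)).
  apply/seteqP; split => t.
    move=> [/ccP/andP[_ ts] /ccP/andP[t0 _]]; rewrite orbitE// in ts.
    by apply/ccP; rewrite t0 -(reach_le Sf s0 t0 sc).
  move=> /ccP/andP[t0 ts]; split; last by apply/ccP; rewrite t0; exact: le_trans sT.
  apply/ccP; rewrite orbitE// (reach_le Sf s0 t0 sc) ts andbT.
  by rewrite -{1}(flow0 c Sf) (pos_nondecr Sf (reach_pos cT)).
by apply: eq_integral => t /set_mem/ccP/andP[t0 _]; rewrite orbitE.
Qed.

Let mp : {measure set (RB R) -> \bar R} :=
  mdensity rho (measurable_pospart mf) (pospart_ge0 f).
Let mn : {measure set (RB R) -> \bar R} :=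
  mdensity rho (measurable_pospart mfN) (pospart_ge0 (-%R \o f)).

Let mpE s : 0 <= s <= T -> mp (cc c (S c s)) = (\int[leb]_(t in cc 0 s) pospart f (S c t))%E.
Proof.
move=> sT; rewrite -(ge0_integral_rho sT)//; first exact: measurable_pospart.
by move=> *; exact: pospart_ge0.
Qed.

Let mnE s : 0 <= s <= T ->
  mn (cc c (S c s)) = (\int[leb]_(t in cc 0 s) pospart (-%R \o f) (S c t))%E.
Proof.
move=> sT; rewrite -(ge0_integral_rho sT)//; first exact: measurable_pospart.
by move=> *; exact: pospart_ge0.
Qed.

Let pospart_fin (g : R -> R) s : 0 <= s -> measurable_fun setT g ->
  (forall x, `|g x| <= M) ->
  (\int[leb]_(t in cc 0 s) pospart g (S c t) < +oo)%E.
Proof.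
move=> s0 mg gM.
apply: (@le_lt_trans _ _ (\int[leb]_(t in cc 0 s) (M%:E))%E); last first.
  by rewrite (integral_cst _ (measurable_cc 0 s))/= lebesgue_cc// -EFinM ltry.
apply: ge0_le_integral => //.
- by move=> *; exact: pospart_ge0.
- apply/measurable_EFinP; apply: measurable_maxr => //.
  apply: (@eq_measurable_fun _ _ _ _ _ (g \o orbit S c)).
    by move=> t /set_mem/ccP/andP[t0 _]; rewrite /= orbitE.
  apply: measurable_funTS; apply: measurableT_comp => //.
  exact: (measurable_orbit Sf).
- move=> t _; rewrite lee_fin ge_max; apply/andP; split.
    exact: le_trans (ler_norm _) (gM _).
  exact: le_trans (normr_ge0 _) (gM 0).
Qed.

(* [f] times the travel time is the length travelled, split into its positive
   and negative parts. *)
Let mpmn A : measurable A -> A `<=` cc c d -> mp A = (leb A + mn A)%E.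
Proof.
move=> mA Acd; rewrite -(measure_addE leb mn).
apply: (measure_unique_segment cd _ _ mA Acd); last first.
  rewrite (mpE (s := T)); last by rewrite T0 lexx.
  exact: (pospart_fin T0 mf fM).
move=> y cyd; have [s [s0 sy _]] := reach_time Sf (cc_reach (proj2 (ccP _ _ _) cyd)).
have sT : 0 <= s <= T.
  by rewrite s0 -(reach_le Sf T0 s0 cT) sy; have /andP[] := cyd.
rewrite [RHS]measure_addE -sy mpE// mnE//.
have [_ [_ /(_ c s s0)[_ cE]]] := fS.
rewrite /= lebesgue_cc; last by rewrite sy; have /andP[] := cyd.
have fp : (\int[leb]_(t in cc 0 s) pospart f (S c t) \is a fin_num)%E.
  by rewrite ge0_fin_numE; [exact: pospart_fin|apply: integral_ge0 => *; exact: pospart_ge0].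
have fn : (\int[leb]_(t in cc 0 s) pospart (-%R \o f) (S c t) \is a fin_num)%E.
  rewrite ge0_fin_numE; last by apply: integral_ge0 => *; exact: pospart_ge0.
  by apply: pospart_fin => // x; rewrite /= normrN.
have IE : (\int[leb]_(t in cc 0 s) (f (S c t))%:E =
    \int[leb]_(t in cc 0 s) pospart f (S c t) -
    \int[leb]_(t in cc 0 s) pospart (-%R \o f) (S c t))%E.
  exact: (integral_pospart (cc 0 s) (f \o S c)).
rewrite IE in cE; rewrite EFinB cE.
by rewrite [(c%:E + _)%E]addeC -(addeA _ c%:E) subee// adde0 subeK.
Qed.

(** [mp] vanishes on [{f <= 0}] and dominates the Lebesgue measure. *)
Let leb_le0 : leb (cc c d `&` [set x | f x <= 0]) = 0%E.
Proof.
have mB : measurable (cc c d `&` [set x | f x <= 0] : set (RB R)).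
  by apply: measurableI => //; exact: mle.
have : (leb (cc c d `&` [set x | (f x <= 0)%R]) <=
    mp (cc c d `&` [set x | (f x <= 0)%R]))%E.
  by rewrite mpmn ?leeDl.
rewrite /mp/= /mdensity integral0_eq; last first.
  by move=> y [_ /= fy]; rewrite /pospart (max_idPr fy).
by move=> h; apply/eqP; rewrite eq_le h measure_ge0.
Qed.

(** On [{f > 0}] the part [mn] vanishes, so [dx] is [mp = f rho] there, and integrating [1/f] gives
    [rho] back. *)
Let rho_gt0 : rho (cc c d `&` [set x | 0 < f x]) =
  (\int[leb]_(x in cc c d) invfp f x)%E.
Proof.
have mB : measurable (cc c d `&` [set x | 0 < f x] : set (RB R)).
  exact: measurableI.
have mB' : measurable (cc c d `&` [set x | f x <= 0] : set (RB R)).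
  by apply: measurableI => //; exact: mle.
have mi := measurable_invfp mf.
rewrite (ge0_negligible_integral mB' (measurable_cc c d))//; last 2 first.
- exact: measurable_funTS.
- by move=> *; exact: invfp_ge0.
have -> : cc c d `\` (cc c d `&` [set x | f x <= 0]) = cc c d `&` [set x | 0 < f x].
  apply/seteqP; split => x [xcd].
    by move=> /not_andP[]// /negP; rewrite -ltNge.
  by move=> /= fx; split => // -[_ /=]; rewrite leNgt fx.
rewrite [RHS](eq_measure_integral mp); last first.
  move=> A mA AB; rewrite mpmn//; last by move=> x /AB[].
  rewrite (_ : mn A = 0%E) ?adde0//; apply: integral0_eq => x /AB[_ /= fx].
  by rewrite /pospart/= (max_idPr _)// oppr_le0 ltW.
rewrite ge0_integral_mdensity//; last exact: invfp_ge0.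
rewrite (eq_integral (cst 1%E)); last first.
  move=> x /set_mem[_ /= fx]; rewrite /pospart /invfp fx (max_idPl (ltW fx)).
  by rewrite -EFinM mulVf// gt_eqF.
by rewrite integral_cst// mul1e.
Qed.

(** [mp] vanishes on [{f < 0}], hence so does the smaller [mn = (-f) rho]; dividing by [-f] shows
    that [rho] vanishes too. *)
Let rho_lt0 : rho (cc c d `&` [set x | f x < 0]) = 0%E.
Proof.
have mB : measurable (cc c d `&` [set x | f x < 0] : set (RB R)).
  exact: measurableI.
have mnB : mn (cc c d `&` [set x | f x < 0]) = 0%E.
  have : mp (cc c d `&` [set x | f x < 0]) = 0%E.
    by apply: integral0_eq => y [_ /= fy]; rewrite /pospart (max_idPr (ltW fy)).
  rewrite mpmn// => h; apply/eqP; rewrite eq_le measure_ge0 andbT -h.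
  by rewrite leeDr.
have mi := measurable_invfp mfN.
have : (\int[mn]_(x in cc c d `&` [set x | (f x < 0)%R]) invfp (-%R \o f) x = 0)%E.
  apply: (ge0_integral_mu0 mB mB) => //.
  - exact: measurable_funTS.
  - by move=> *; exact: invfp_ge0.
rewrite ge0_integral_mdensity//; last exact: invfp_ge0.
rewrite (eq_integral (cst 1%E)); last first.
  move=> x /set_mem[_ /= fx]; have nfx : 0 < - f x by rewrite oppr_gt0.
  rewrite /pospart /invfp/= nfx (max_idPl (ltW nfx)).
  by rewrite -EFinM mulVf// gt_eqF.
by rewrite integral_cst// mul1e.
Qed.

Lemma occ_travel_time :
  (occ Sf c (cc c d `&` f @^-1` [set 0%R]) + intcc c d (invfp f) = T%:E)%E.
Proof.
have mZ : measurable (cc c d `&` f @^-1` [set 0] : set (RB R)).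
  by apply: measurableI => //; rewrite -[X in measurable X]setTI; exact: mf.
have mL : measurable (cc c d `&` [set x | f x < 0] : set (RB R)).
  exact: measurableI.
have mG : measurable (cc c d `&` [set x | 0 < f x] : set (RB R)).
  exact: measurableI.
have -> : occ Sf c (cc c d `&` f @^-1` [set 0]) = rho (cc c d `&` f @^-1` [set 0]).
  rewrite occE /rho/= /mpush/= /mrestr; congr (leb _).
  apply/seteqP; split => t.
    move=> [t0 [[tcd ft] tc]]; rewrite /= orbitE//; split => //.
    have /andP[_ td] := (ccP _ _ _).1 tcd.
    by apply/ccP; rewrite t0 -(reach_le Sf T0 t0 cT).
  move=> [/= tcd /ccP/andP[t0 tT]]; rewrite orbitE// in tcd.
  by split => //; split => //; apply: cc_reach; exact: tcd.1.
rewrite /intcc -rho_gt0.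
have -> : T%:E = rho (cc c d).
  have := @ge0_integral_rho T (cst 1%E) ltac:(by rewrite T0 lexx).
  rewrite !(integral_cst _ (measurable_cc _ _))/= !mul1e lebesgue_cc// subr0.
  by move=> ->.
have UE : (cc c d `&` f @^-1` [set 0]) `|` (cc c d `&` [set x | 0 < f x])
    `|` (cc c d `&` [set x | f x < 0]) = cc c d.
  apply/seteqP; split => [x [[]|] []//|x xcd].
  have [fx|fx|fx] := ltgtP (f x) 0; [right|left; right|left; left] => //.
rewrite -[in RHS]UE measureU//; last 2 first.
- exact: measurableU.
- apply/seteqP; split => // x [[[_ /= h]|[_ /= h]] [_ /=]]; rewrite ?h ?ltxx//.
  by move=> /(lt_trans h); rewrite ltxx.
rewrite [X in _ = (_ + X)%E]rho_lt0 adde0 measureU//.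
by apply/seteqP; split => // x [[_ /= ->] [_ /=]]; rewrite ltxx.
Qed.

End travel_time.

(** * The measure that detects uncountable sets of fixed points *)

Section uncountability_measure.
Context {R : realType}.
Implicit Types (Z A : set R) (x e : R).

Lemma countable_setU (T : Type) (A B : set T) : countable A -> countable B ->
  countable (A `|` B).
Proof.
move=> cA cB; rewrite (_ : A `|` B = \bigcup_(b : bool) if b then A else B).
  by apply: bigcup_countable => // -[].
apply/seteqP; split => [x [Ax|Bx]|x [[] _]]; [by exists true|by exists false| |];
  by [left|right].
Qed.

Lemma countable_opp A : countable A -> countable [set x | A (- x)].
Proof.
move=> /countable_injP[h hi]; apply/countable_injP; exists (h \o -%R) => x y.
by rewrite !inE => Ax Ay /= hxy; apply: oppr_inj; apply: hi => //; rewrite inE.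
Qed.

Lemma sub_countableW A B : A `<=` B -> countable B -> countable A.
Proof. by move=> AB; apply: sub_countable; exact: subset_card_le. Qed.

Definition kappa Z (A : set (RB R)) : \bar R :=
  if `[< countable (A `&` Z) >] then 0%E else +oo%E.

Section kappa.
Variable Z : set R.

Lemma kappa_countable A : countable (A `&` Z) -> kappa Z A = 0%E.
Proof. by move=> cA; rewrite /kappa asboolT. Qed.

Lemma kappa_lty A : (kappa Z A < +oo)%E -> countable (A `&` Z).
Proof. by rewrite /kappa; case: asboolP. Qed.

Let kappa0 : kappa Z set0 = 0%E.
Proof. by apply: kappa_countable; rewrite set0I. Qed.

Let kappa_ge0 A : (0 <= kappa Z A)%E.
Proof. by rewrite /kappa; case: ifP. Qed.

(** Either all pieces have a countable trace on [Z], and so has their union, or one piece already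
    contributes [+oo]. *)
Let kappa_sigma_additive : semi_sigma_additive (kappa Z).
Proof.
move=> F mF tF mUF.
have [cF|] := pselect (forall n, countable (F n `&` Z)).
  rewrite kappa_countable; last first.
    by rewrite setI_bigcupl; apply: bigcup_countable.
  rewrite (_ : (fun n => _) = cst 0%E); first exact: cvg_cst.
  by apply/funext => n /=; rewrite big1// => i _; exact: kappa_countable.
move=> /existsNP[k nck].
have kk : kappa Z (F k) = +oo%E by rewrite /kappa asboolF.
have -> : kappa Z (\bigcup_n F n) = +oo%E.
  rewrite /kappa asboolF// => h; apply: nck; apply: sub_countableW h.
  by apply: setSI; exact: bigcup_sup.
apply: cvg_near_cst; exists k.+1 => // n /= kn.
rewrite big_mkord (bigD1 (Ordinal kn))//= kk addye//.
rewrite -ltNye; apply: (@lt_le_trans _ _ 0%E) => //.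
by apply: sume_ge0 => i _; exact: kappa_ge0.
Qed.

HB.instance Definition _ := isMeasure.Build _ (RB R) R (kappa Z)
  kappa0 kappa_ge0 kappa_sigma_additive.

End kappa.

Definition thin Z : set R := [set x | Z x /\ exists2 e, 0 < e &
  countable (cc x (x + e) `&` Z) \/ countable (cc (x - e) x `&` Z)].

(** If the trace of [Z] is countable on both sides, the point lies in one of the countably many
    rational segments with countable trace ([D]). Otherwise it is countable on one side and
    uncountable on the other, and such points are isolated among themselves on the countable side
    ([Er], [El]). *)
Lemma countable_thin Z : countable (thin Z).
Proof.
pose D (p : rat * rat) : set R :=
  if `[< countable (cc (ratr p.1) (ratr p.2) `&` Z) >]
  then cc (ratr p.1) (ratr p.2) `&` Z else set0.
pose Er := [set x | (exists2 e, 0 < e & countable (cc x (x + e) `&` Z)) /\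
  forall y, y < x -> ~ countable (cc y x `&` Z)].
pose El := [set x | (exists2 e, 0 < e & countable (cc (x - e) x `&` Z)) /\
  forall y, x < y -> ~ countable (cc x y `&` Z)].
apply: (@sub_countableW _ (\bigcup_p D p `|` (Er `|` El))); last first.
  apply: countable_setU.
    by apply: bigcup_countable => // p _; rewrite /D; case: asboolP.
  apply: countable_setU.
    apply: countable_right_isolated => x [[e e0 xe] _]; exists e => // y.
    move=> /andP[xy yx] [_ /(_ x xy)]; apply; apply: sub_countableW xe.
    by apply: setSI; apply: subset_cc => //; exact: ltW.
  apply: countable_left_isolated => x [[e e0 xe] _]; exists e => // y.
  move=> /andP[xy yx] [_ /(_ x yx)]; apply; apply: sub_countableW xe.
  by apply: setSI; apply: subset_cc => //; exact: ltW.
have two x y z : Z x -> y < x -> x < z -> countable (cc y x `&` Z) ->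
    countable (cc x z `&` Z) -> (\bigcup_p D p) x.
  move=> Zx yx xz cyx cxz.
  have [p /itvP py] := rat_in_itvoo yx; have [q /itvP qz] := rat_in_itvoo xz.
  exists (p, q) => //; rewrite /D/= asboolT.
    by split => //; apply/ccP; rewrite !ltW ?py ?qz.
  apply: sub_countableW (countable_setU cyx cxz) => t [/ccP/andP[pt tq] Zt].
  have [tx|xt] := leP t x; [left|right]; split=> //; apply/ccP.
    by rewrite tx andbT (le_trans _ pt)// ltW// py.
  by rewrite (ltW xt)/= (le_trans tq)// ltW// qz.
move=> x [Zx [e e0 [xe|xe]]].
- have [xl|nxl] := pselect (exists2 y, y < x & countable (cc y x `&` Z)).
    have [y yx cyx] := xl; left; apply: (two x y (x + e)) => //; lra.
  right; left; split; first by exists e.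
  by move=> y yx cyx; apply: nxl; exists y.
- have [xl|nxl] := pselect (exists2 y, x < y & countable (cc x y `&` Z)).
    have [y yx cyx] := xl; left; apply: (two x (x - e) y) => //; lra.
  right; right; split; first by exists e.
  by move=> y yx cyx; apply: nxl; exists y.
Qed.

End uncountability_measure.

(** * Right-moving orbits follow the construction *)

Section increasing_side.
Context {R : realType}.
Implicit Types (f : R -> R) (mu : {measure set (RB R) -> \bar R}) (Sg : set R).
Implicit Types (S : R -> R -> R) (a b : \bar R) (c d e s t x y z : R).

(** With the hypotheses below, this is all that is retained of [mu] and [Sg]; the section then
    serves for the flow and for its reflection. *)
Definition hit_times f mu S := forall c T, 0 <= T -> reach S c (S c T) ->
  (mu (cc c (S c T)) + intcc c (S c T) (invfp f) = T%:E)%E.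

Variables (f : R -> R) (mf : measurable_fun setT f).
Variables (M : R) (S : R -> R -> R).
Hypothesis Sf : bounded_flow M S.
Variable mu : {measure set (RB R) -> \bar R}.
Hypothesis mu1 : forall x, mu [set x] = 0%E.
Variable Sg : set R.
Hypothesis hit : hit_times f mu S.
Hypothesis mu_fixd : forall c d, (mu (cc c d) < +oo)%E ->
  countable (cc c d `&` fixd S).
Hypothesis neg_invfp : forall x e, neg S x -> 0 < e ->
  intcc (x - e) x (invfp f) = +oo%E.
Hypothesis Sg_fixd : Sg `<=` fixd S.
Hypothesis fixd_Sg : forall x e, fixd S x -> 0 < e ->
  countable (cc x (x + e) `&` fixd S) -> Sg x.

Local Notation m := (hitm mf mu).

Let hitE c T : 0 <= T -> reach S c (S c T) -> m (cc c (S c T)) = T%:E.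
Proof. by move=> T0 cT; rewrite hitmE; exact: hit. Qed.

Let lty_not_fixd x d : x < d -> ~ Sg x -> (m (cc x d) < +oo)%E -> ~ fixd S x.
Proof.
move=> xd nSx /(hitm_lty (measurable_cc _ _))[/mu_fixd cx _] fx; apply: nSx.
by apply: (fixd_Sg fx (e := d - x)); rewrite ?subr_gt0// addrC subrK.
Qed.

(** Finite hitting times exclude left-moving and fixed points from the domain, so each of its points
    moves right. An orbit that never passed [d] would have to come to rest inside the domain. *)
Lemma dom_inc_reach a b c d : dom_inc f mu Sg a b -> (a < c%:E)%E -> c <= d ->
  (d%:E < b)%E -> reach S c d.
Proof.
move=> /(dom_incP mf)[ab abS abm] ac cd db.
have ab_pos z : (a < z%:E < b)%E -> pos S z.
  move=> /andP[az zb]; have [//|nz|fz] := pos_neg_fixd S z; exfalso.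
    have [y /andP[ay yz]] := ereal_between az; rewrite lte_fin in yz.
    have /(hitm_lty (measurable_cc _ _))[_] := abm y z (ltW yz) ay zb.
    have := neg_invfp nz (e := z - y); rewrite subr_gt0 => /(_ yz).
    by rewrite /intcc subKr => ->.
  have [y /andP[zy yb]] := ereal_between zb; rewrite lte_fin in zy.
  apply: (lty_not_fixd zy _ (abm z y (ltW zy) az yb)) fz.
  by apply: abS; rewrite az.
have pc : pos S c by apply: ab_pos; rewrite ac (le_lt_trans _ db)// lee_fin.
apply: contrapT => ncd.
have Sd t : 0 <= t -> S c t <= d.
  by move=> t0; rewrite leNgt; apply/negP => dt; apply: ncd; split => //; exists t.
have cdoo := abm c d cd ac db.
(* By the time [K + 1], longer than the hitting time of the whole of [[c, d]], an orbit confined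
   below [d] has stopped moving. *)
pose K := fine (m (cc c d)).
have KE : m (cc c d) = K%:E by rewrite fineK// ge0_fin_numE.
have K0 : 0 <= K by rewrite -lee_fin -KE.
have K1 : 0 <= K + 1 by lra.
have cz : c <= S c (K + 1) by rewrite -{1}(flow0 c Sf); exact: (pos_nondecr Sf).
have nz : ~ reach S c (S c (K + 1)).
  move=> /(hitE K1) zE; have := le_measure_cc m (lexx c) (Sd _ K1).
  by rewrite zE KE lee_fin; lra.
apply: (@pos_fixd _ S (S c (K + 1))).
  apply: ab_pos; apply/andP; split; first by apply: lt_le_trans ac _; rewrite lee_fin.
  by apply: le_lt_trans db; rewrite lee_fin; exact: Sd.
move=> t t0; rewrite (flowD _ Sf)//; apply/eqP; rewrite eq_le.
rewrite (pos_nondecr Sf pc K1) ?andbT; last lra.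
rewrite leNgt; apply/negP => h; apply: nz; split => //.
by exists (t + (K + 1)) => //; lra.
Qed.

Lemma reach_hitm_lty c d : reach S c d -> (m (cc c d) < +oo)%E.
Proof.
move=> cd; have [T [T0 TE _]] := reach_time Sf cd.
by rewrite -TE hitE ?TE// ltry.
Qed.

Lemma reach_dom_inc c d : reach S c d -> c < d -> dom_inc f mu Sg c%:E d%:E.
Proof.
move=> cd cltd; apply/(dom_incP mf); split; first by rewrite lte_fin.
- move=> x; rewrite !lte_fin => /andP[cx xd] /Sg_fixd.
  apply: pos_fixd; have [|s [_ _]//] := @reach_time _ _ S c x Sf.
  by apply: (reach_down cd); exact: ltW.
- move=> c' d' _; rewrite !lte_fin => cc' dd'.
  by apply: le_lt_trans (reach_hitm_lty cd); apply: le_measure_cc; exact: ltW.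
Qed.

Lemma pos_reach x b : pos S x -> (x%:E < b)%E ->
  exists y, [/\ x < y, (y%:E < b)%E & reach S x y].
Proof.
move=> [t t0 xt] xb.
have [y] : exists y, (x%:E < y%:E < Order.min b (S x t)%:E)%E.
  by apply: ereal_between; rewrite lt_min xb lte_fin.
rewrite lt_min !lte_fin => /andP[xy /andP[yb yt]]; exists y; split => //.
by split; [exact: ltW|exists t].
Qed.

Lemma pos_in_Iplus x : pos S x -> in_Iplus f mu Sg x.
Proof.
move=> px; have [y [xy _ xRy]] := pos_reach px (ltry x).
apply: (@in_Iplus_intro _ _ mf mu mu1 _ x y%:E (y - x)).
- exact: reach_dom_inc.
- by move=> /Sg_fixd; exact: pos_fixd.
- by rewrite subr_gt0.
- by rewrite addrC subrK; exact: reach_hitm_lty.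
Qed.

Lemma in_Iplus_not_fixd x : in_Iplus f mu Sg x -> ~ fixd S x.
Proof.
move=> [a [b [[ab _] xI]]]; have [_ xb nSx xd] := Iplus_lty mf mu1 ab xI.
have [d /andP[xd' db]] := ereal_between xb; rewrite lte_fin in xd'.
exact: lty_not_fixd xd' nSx (xd d db).
Qed.

(** Continuity from below along segments exhausting [[x, y[]; the endpoint [y] is null. *)
Lemma measure_cc_sup (nu : {measure set (RB R) -> \bar R}) x y t :
  (forall z, nu [set z] = 0%E) -> x < y ->
  (forall d, x <= d -> d < y -> (nu (cc x d) <= t%:E)%E) -> (nu (cc x y) <= t%:E)%E.
Proof.
move=> nu1 xy nut.
rewrite -(measure_setD1 (measurable_cc x y) (nu1 y)).
pose F n := cc x (y - (y - x) / n.+1%:R).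
have F_lt n : x <= y - (y - x) / n.+1%:R < y.
  have n0 : 0 < n.+1%:R :> R by [].
  have h : (y - x) / n.+1%:R <= y - x.
    rewrite ler_pdivrMr// ler_peMr//; first by rewrite subr_ge0 ltW.
    by rewrite ler1n.
  have h' : 0 < (y - x) / n.+1%:R by rewrite divr_gt0// subr_gt0.
  by rewrite gtrBl h' lerBrDr addrC -lerBrDr h.
have UF : cc x y `\` [set y] = \bigcup_n F n.
  apply/seteqP; split => z.
    move=> [/ccP/andP[xz zy] /eqP nzy].
    have zy' : z < y by rewrite lt_neqAle nzy.
    pose n := Num.truncn ((y - x) / (y - z)).
    exists n => //; apply/ccP; rewrite xz/= lerBrDr addrC -lerBrDr.
    rewrite ler_pdivrMr// mulrC -ler_pdivrMr ?subr_gt0//.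
    exact: ltW (truncnS_gt _).
  move=> [n _ /ccP/andP[xz zn]]; have /andP[h1 h2] := F_lt n.
  split; first by apply/ccP; rewrite xz (le_trans zn)// ltW.
  by move=> /= zy; move: (le_lt_trans zn h2); rewrite zy ltxx.
rewrite UF.
have ndF : nondecreasing_seq F.
  move=> n k nk; apply/subsetPset; apply: subset_cc => //.
  rewrite lerD2l lerN2 ler_pM2l ?subr_gt0// lef_pV2 ?posrE//.
  by rewrite ler_nat.
have mUF : measurable (\bigcup_n F n) by apply: bigcupT_measurable => n; exact: measurable_cc.
have cF := nondecreasing_cvg_mu (mu := nu) (fun n => measurable_cc _ _) mUF ndF.
rewrite -(cvg_lim _ cF)//; apply: lime_le; first by apply/cvg_ex; eexists; exact: cF.
by apply: nearW => n; have /andP[] := F_lt n; exact: nut.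
Qed.

Lemma pos_Splus_spec x0 t : pos S x0 -> 0 <= t -> Splus_spec f mu Sg x0 t (S x0 t).
Proof.
move=> px t0 a b abmax xI /=.
have [ax xb nSx xd] := Iplus_lty mf mu1 abmax.1 xI.
(* [x0] may be the left endpoint [a], outside the open domain: one first moves to a reached
   [y > x0], then inside the domain. *)
have r1 d : x0 <= d -> (d%:E < b)%E -> reach S x0 d.
  move=> xd' db; have [y [xy yb xRy]] := pos_reach px xb.
  have [dy|yd] := leP d y; first exact: reach_down xRy _ dy.
  apply: (reach_trans Sf xRy); apply: (dom_inc_reach abmax.1) => //; last exact: ltW.
  by apply: le_lt_trans ax _; rewrite lte_fin.
have x0t : x0 <= S x0 t by rewrite -{1}(flow0 x0 Sf); exact: (pos_nondecr Sf).
have r2 : ((S x0 t)%:E <= b)%E.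
  rewrite leNgt; apply/negP => bt.
  have [d /andP[bd dt]] := ereal_between bt; rewrite lte_fin in dt.
  have xd' : x0 < d by rewrite -lte_fin; exact: lt_trans bd.
  have xRd : reach S x0 d by split; [exact: ltW|exists t].
  have [z /andP[xz zb]] := ereal_between xb.
  have [] := max_dom_inc_ge mf mu1 abmax (reach_dom_inc xRd xd') (z := z).
  - by rewrite zb (le_lt_trans ax).
  - by rewrite xz (lt_trans zb).
  - by move=> _; rewrite leNgt bd.
split.
- move=> ttau.
  (* Otherwise all of [[x0, b[] is reached by time [t]. For finite [b] this bounds the total time by
     [t], against [ttau]; for [b = +oo] the position at time [t] would bound all reals. *)
  have [d [xd' db td]] : exists d, [/\ x0 <= d, (d%:E < b)%E & (t%:E < m (cc x0 d))%E].
    apply: contrapT => /forallNP h.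
    have le_t d : x0 <= d -> (d%:E < b)%E -> (m (cc x0 d) <= t%:E)%E.
      by move=> xd' db; rewrite leNgt; apply/negP => td; apply: (h d).
    have ge_d d : x0 <= d -> (d%:E < b)%E -> d <= S x0 t.
      move=> xd' db; have [T [T0 TE _]] := reach_time Sf (r1 d xd' db).
      have := le_t d xd' db; rewrite -TE hitE ?lee_fin//; last by rewrite TE; exact: r1.
      by move=> Tt; exact: (pos_nondecr Sf).
    case: b xb ttau le_t ge_d r2 {abmax xI xd r1 h} => [be| |]//.
      rewrite lte_fin => xb; rewrite (Fplus_fin mf) => ttau le_t _ _.
      have : (m (cc x0 be) <= t%:E)%E.
        by apply: measure_cc_sup => //; move=> z; exact: hitm_set1.
      by rewrite leNgt ttau.
    move=> _ _ _ ge_d _.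
    by have := ge_d (S x0 t + 1) ltac:(lra) (ltry _); lra.
  have xRd := r1 d xd' db.
  have [T [T0 TE _]] := reach_time Sf xRd; rewrite -TE in xRd.
  have tT : t < T by rewrite -lte_fin -(hitE T0 xRd) TE.
  have tyd : S x0 t <= S x0 T by exact: (pos_nondecr Sf px t0 (ltW tT)).
  split => //; split; first by apply: le_lt_trans db; rewrite lee_fin -TE.
  by rewrite (Fplus_fin mf) hitE//; exact: reach_down xRd x0t tyd.
- move=> taut; apply/eqP; rewrite eq_le r2/= leNgt; apply/negP => yb.
  have [d /andP[yd db]] := ereal_between yb; rewrite lte_fin in yd.
  have xd' : x0 <= d by rewrite (le_trans x0t)// ltW.
  have [T [T0 TE _]] := reach_time Sf (r1 d xd' db).
  have Tt : T <= t.
    rewrite -lee_fin -(hitE (c := x0) T0); last by rewrite TE; exact: r1.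
    by rewrite TE; apply: le_trans taut; apply: le_Fplus; exact: ltW.
  by have := pos_nondecr Sf px T0 Tt; rewrite TE leNgt yd.
Qed.

End increasing_side.

(** * From a compatible semigroup to the construction *)

Section compatible_is_constructed.
Context {R : realType}.
Implicit Types (f : R -> R) (mu : {measure set (RB R) -> \bar R}) (M : R).
Implicit Types (S : R -> R -> R) (c d e s t x y z : R).

Lemma flowreflK S : flowrefl (flowrefl S) = S.
Proof. by apply/funext => x; apply/funext => t; rewrite /flowrefl !opprK. Qed.

Lemma pos_refl S x : pos (flowrefl S) (- x) <-> neg S x.
Proof.
split=> -[t t0 xt]; exists t => //; move: xt; rewrite /flowrefl ?opprK ltrN2//.
Qed.

Lemma fixd_refl S x : fixd (flowrefl S) (- x) <-> fixd S x.
Proof.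
split=> h t t0; have := h t t0; rewrite /flowrefl opprK; last by move->.
exact: oppr_inj.
Qed.

Lemma fixd_zero f S x : compatible_semigroup f S -> fixd S x -> f x = 0.
Proof.
move=> [_ [_ Sc]] fx; have [_] := Sc x 1 ler01.
rewrite fx// (eq_integral (cst (f x)%:E)); last first.
  by move=> s /set_mem/ccP/andP[s0 _]; rewrite fx.
rewrite (integral_cst _ (measurable_cc 0 1))/= lebesgue_cc// subr0 mule1 -EFinD.
by move=> [] h; lra.
Qed.

Lemma occupation_hit_times f M S mu (mf : measurable_fun setT f)
    (fM : forall x, `|f x| <= M) (fS : compatible_semigroup f S) :
  (forall c d, (forall y, cc c d y -> pos S y) -> mu (cc c d) =
    occupation (compatible_bounded_flow fM fS) (cc c d `&` f @^-1` [set 0])) ->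
  hit_times f mu S.
Proof.
move=> muE c T T0 cT; have Sf := compatible_bounded_flow fM fS.
have ccR y : cc c (S c T) y -> reach S c y.
  by move=> /ccP/andP[cy yd]; exact: reach_down cT cy yd.
rewrite muE; last by move=> y /ccR/(reach_time Sf)[s []].
rewrite (occupation_reach _ (c := c)); [exact: occ_travel_time| |by move=> y [/ccR]].
by apply: measurableI => //; rewrite -[X in measurable X]setTI; exact: mf.
Qed.

(** A left-moving point crosses a segment on its left in finite time, so [f < 0] almost everywhere
    there and [1/f^+] is infinite. *)
Lemma hit_times_neg_invfp f M S mu x e : measurable_fun setT f ->
  bounded_flow M S -> hit_times (refl f) mu (flowrefl S) -> neg S x -> 0 < e ->
  intcc (x - e) x (invfp f) = +oo%E.
Proof.
move=> mf Sf hit nx e0; have Sfr := bounded_flow_refl Sf.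
have [y [xy _ xRy]] := pos_reach ((pos_refl S x).2 nx) (ltry (- x)).
have mfr := measurable_refl mf.
have [T [T0 TE _]] := reach_time Sfr xRy; rewrite -TE in xRy xy.
have yoo : (hitm mfr mu (cc (- x) (flowrefl S (- x) T)) < +oo)%E.
  by rewrite hitmE [X in (X < _)%E](hit _ _ T0 xRy) ltry.
have := (hitm_lty (measurable_cc _ _) yoo).2.
rewrite -/(intcc _ _ _) intcc_refl// TE opprK => foo.
apply/eqP; rewrite -leye_eq leNgt; apply/negP => eoo.
rewrite TE in xy.
pose d := Num.min e (x + y).
have d0 : 0 < d by rewrite lt_min e0; lra.
have de : d <= e by rewrite ge_min lexx.
have dy : d <= x + y by rewrite ge_min lexx orbT.
have mfN : measurable_fun setT (-%R \o f) by exact: measurableT_comp.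
apply: (@invfp_invfm_disjoint _ _ mf (x - d) x); first lra.
  by apply: le_lt_trans eoo; apply: (intcc_invfp_le mf) => //; lra.
apply: le_lt_trans foo; rewrite !intcc_invfm !oppeK.
by apply: (intcc_invfp_le mfN) => //; lra.
Qed.

Lemma compatible_constructed f S : A1 f -> compatible_semigroup f S ->
  exists mu (Sg : set R) (Phi : R -> R),
    (forall x, mu [set x] = 0%E) /\
    mu (~` (f @^-1` [set 0])) = 0%E /\
    countable Sg /\ Sg `<=` f @^-1` [set 0] /\
    (forall x, Omega_star f x -> Phi x = 1 \/ Phi x = -1) /\
    constructed_semigroup f mu Sg Phi S.
Proof.
move=> [[M fM] rf] fS.
have mf := regulated_measurable rf; have mfr := measurable_refl mf.
have fMr := refl_bound fM; have fSr := compatible_semigroup_refl fS.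
pose Sf := compatible_bounded_flow fM fS.
pose Sfr := compatible_bounded_flow fMr fSr.
have mzero_set (g : R -> R) : measurable_fun setT g ->
    measurable (g @^-1` [set 0] : set (RB R)).
  by move=> mg; rewrite -[X in measurable X]setTI; exact: mg.
pose Z := fixd S.
pose mup := mrestr (occupation Sf) (mzero_set _ mf).
pose mum := mrestr (occupation Sfr) (mzero_set _ mfr).
(* On a segment of right-moving points only the first summand is nonzero, on one of left-moving
   points only the second; so the three do not disturb each other's hitting times. *)
pose mu : {measure set (RB R) -> \bar R} :=
  measure_add (measure_add mup (mrefl mum)) (kappa Z).
have muE0 A : mu A = (mup A + mrefl mum A + kappa Z A)%E.
  transitivity (measure_add mup (mrefl mum) A + kappa Z A)%E.
    exact: measure_addE.
  by congr (_ + _)%E; exact: measure_addE.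
have muE A : mu A = (occupation Sf (A `&` f @^-1` [set 0%R]) +
    occupation Sfr ([set y | A (- y)%R] `&` refl f @^-1` [set 0%R]) + kappa Z A)%E.
  by rewrite muE0.
have mu1 x : mu [set x] = 0%E.
  rewrite muE0 mrefl_set1 /mup /mum/= /mrestr.
  have occ0 (g : R -> R) (S' : R -> R -> R) (Sf' : bounded_flow M S') y :
      measurable_fun setT g -> occupation Sf' ([set y] `&` g @^-1` [set 0]) = 0%E.
    move=> mg; apply/eqP; rewrite eq_le measure_ge0 andbT -(occupation_set1 Sf' y).
    by rewrite le_measure ?inE//; apply: measurableI => //; exact: (mzero_set g mg).
  rewrite occ0// occ0// kappa_countable ?adde0//.
  by apply: (@sub_countableW _ _ [set x]) => // y [].
have Zf x : Z x -> f x = 0 by exact: fixd_zero fS.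
have muf : mu (~` (f @^-1` [set 0])) = 0%E.
  rewrite muE0 -(mrefl_support f) mreflE.
  rewrite /mup /mum/= /mrestr setICl measure0 add0e.
  rewrite (_ : _ `&` refl f @^-1` [set 0] = set0); last first.
    apply/seteqP; split => y //= [h1 h2]; apply: h1.
    by rewrite opprK.
  rewrite measure0 add0e kappa_countable// (_ : _ `&` Z = set0)//.
  by apply/seteqP; split => y // [/= nfy /Zf].
have hitp : hit_times f mu S.
  apply: (@occupation_hit_times f M S mu mf fM fS) => c d cdpos.
  rewrite muE (occupation_nonpos (S := flowrefl S)); last first.
    move=> y [/cdpos py _]; rewrite -[y]opprK pos_refl.
    exact: (pos_neg Sf).
  rewrite adde0 kappa_countable ?adde0// (_ : _ `&` Z = set0)//.
  by apply/seteqP; split => y // [/cdpos /pos_fixd].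
have hitm : hit_times (refl f) (mrefl mu) (flowrefl S).
  apply: (@occupation_hit_times (refl f) M (flowrefl S) (mrefl mu) mfr fMr fSr).
  move=> c d cdpos; rewrite mrefl_cc muE (occupation_nonpos (S := S)); last first.
    move=> y [ycd _]; suff ny : neg S y by move=> py; exact: (pos_neg Sf py ny).
    apply/pos_refl/cdpos; move: ycd => /ccP; rewrite -/(cc _ _ _) => h.
    by apply/ccP; rewrite lerNr lerNl andbC.
  rewrite add0e kappa_countable ?adde0 ?cc_opp ?opprK//.
  rewrite (_ : _ `&` Z = set0)//; apply/seteqP; split => y // [/ccP h].
  apply: neg_fixd; apply/pos_refl/cdpos; apply/ccP.
  by rewrite lerNr lerNl andbC.
have mu_fixd c d : (mu (cc c d) < +oo)%E -> countable (cc c d `&` fixd S).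
  move=> h; apply: kappa_lty; apply: le_lt_trans h.
  by rewrite muE leeDr// adde_ge0.
have opp_fixd c d : [set y | (cc (- d) (- c) `&` fixd S) (- y)] =
    cc c d `&` fixd (flowrefl S).
  apply/seteqP; split => y [/ccP h fy]; split.
  - by apply/ccP; move: h; rewrite !lerN2 andbC.
  - by rewrite -[y]opprK; apply/fixd_refl.
  - by apply/ccP; rewrite !lerN2 andbC.
  - by apply/fixd_refl; rewrite opprK.
have mur_fixd c d : (mrefl mu (cc c d) < +oo)%E ->
    countable (cc c d `&` fixd (flowrefl S)).
  by rewrite mrefl_cc => /mu_fixd/countable_opp; rewrite opp_fixd.
have negp x e : neg S x -> 0 < e -> intcc (x - e) x (invfp f) = +oo%E.
  exact: (hit_times_neg_invfp mf Sf hitm).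
have negm x e : neg (flowrefl S) x -> 0 < e ->
    intcc (x - e) x (invfp (refl f)) = +oo%E.
  apply: (hit_times_neg_invfp (mu := mu) mfr Sfr).
  by rewrite reflK flowreflK.
(* A fixed point outside [thin Z] has uncountably many fixed points arbitrarily near on each side,
   so [kappa] prevents leaving it either way; the others are held by [Sg]. *)
pose Sg := thin Z.
have Sg_fixd : Sg `<=` fixd S by move=> x [].
have Sgr_fixd : srefl Sg `<=` fixd (flowrefl S).
  by move=> x [fx _]; rewrite -[x]opprK; apply/fixd_refl.
have fixd_Sg x e : fixd S x -> 0 < e ->
    countable (cc x (x + e) `&` fixd S) -> Sg x.
  by move=> fx e0 cx; split => //; exists e => //; left.
have fixd_Sgr x e : fixd (flowrefl S) x -> 0 < e ->
    countable (cc x (x + e) `&` fixd (flowrefl S)) -> srefl Sg x.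
  move=> fx e0; rewrite -opp_fixd => /countable_opp cx; split.
    by apply/fixd_refl; rewrite opprK.
  exists e => //; right; apply: sub_countableW cx => y.
  by rewrite /= opprK opprD.
have mur1 x : mrefl mu [set x] = 0%E by rewrite mrefl_set1.
have pos_Ip x : pos S x -> in_Iplus f mu Sg x.
  exact: (pos_in_Iplus mf Sf mu1 hitp Sg_fixd).
have neg_Im x : neg S x -> in_Iminus f mu Sg x.
  rewrite -pos_refl -[x in in_Iminus _ _ _ x]opprK -in_Iplus_refl//.
  exact: (pos_in_Iplus mfr Sfr mur1 hitm Sgr_fixd).
have Ip_nfix x : in_Iplus f mu Sg x -> ~ fixd S x.
  exact: (in_Iplus_not_fixd mf mu1 mu_fixd fixd_Sg).
have Im_nfix x : in_Iminus f mu Sg x -> ~ fixd S x.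
  rewrite -fixd_refl -[x in in_Iminus _ _ _ x]opprK -in_Iplus_refl//.
  exact: (in_Iplus_not_fixd mfr mur1 mur_fixd fixd_Sgr).
have pos_sp x t : pos S x -> 0 <= t -> Splus_spec f mu Sg x t (S x t).
  exact: (pos_Splus_spec mf Sf mu1 hitp mu_fixd negp Sg_fixd fixd_Sg).
have neg_sp x t : neg S x -> 0 <= t -> Sminus_spec f mu Sg x t (S x t).
  rewrite -pos_refl => nx t0.
  have := pos_Splus_spec mfr Sfr mur1 hitm mur_fixd negm Sgr_fixd fixd_Sgr nx t0.
  by move/Splus_spec_refl => /(_ mf); rewrite /flowrefl !opprK.
(* [Phi] is consulted at points of both [in_Iplus] and [in_Iminus]. These are not fixed, so one that
   does not move right moves left. *)
pose Phi x : R := if `[< pos S x >] then 1 else -1.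
exists mu, Sg, Phi; do 2 split => //; split; first exact: countable_thin.
split; first by move=> x [/Zf].
split; first by move=> x _; rewrite /Phi; case: ifP; [left|right].
move=> x t t0; split; [|split; [|split]].
- move=> nIp nIm; have [/pos_Ip//|/neg_Im//|fx] := pos_neg_fixd S x.
  exact: fx.
- move=> Ip nIm; have [px|/neg_Im//|/(Ip_nfix _ Ip)//] := pos_neg_fixd S x.
  exact: pos_sp.
- move=> nIp Im; have [/pos_Ip//|nx|/(Im_nfix _ Im)//] := pos_neg_fixd S x.
  exact: neg_sp.
- move=> Ip Im; rewrite /Phi; case: asboolP => [px|npx]; split => h.
  + exact: pos_sp.
  + by exfalso; move: h; lra.
  + by exfalso; move: h; lra.
  + have [//|nx|/(Im_nfix _ Im)//] := pos_neg_fixd S x.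
    exact: neg_sp.
Qed.

End compatible_is_constructed.

Theorem theorem3p5 (R : realType) (f : R -> R) :
  A1 f -> A2 f ->
  forall S : R -> R -> R,
    compatible_semigroup f S <->
    exists (mu : {measure set (measurableTypeR R) -> \bar R}) (Sg : set R) (Phi : R -> R),
      (forall x : R, mu [set x] = 0%E) /\
      mu (~` (f @^-1` [set 0])) = 0%E /\
      countable Sg /\ Sg `<=` f @^-1` [set 0] /\
      (forall x, Omega_star f x -> Phi x = 1 \/ Phi x = -1) /\
      constructed_semigroup f mu Sg Phi S.
Proof.
move=> fA1 fA2 S; split; first exact: compatible_constructed.
move=> [mu [Sg [Phi [mu1 [muf [_ [Sgf [PhiP SP]]]]]]]].
exact: (constructed_compatible fA1 fA2 mu1 muf Sgf PhiP SP).
Qed.
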